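(* Let $\mathcal{H}_1,\mathcal{H}_2$ be real Hilbert spaces and $\mathcal{H}=\mathcal{H}_1\times\mathcal{H}_2$. Let $K\colon\mathcal{H}_1\to\mathcal{H}_2$ be bounded linear, let $g\colon\mathcal{H}_1\to\mathbb{R}\cup\{+\infty\}$ and $f\colon\mathcal{H}_2\to\mathbb{R}\cup\{+\infty\}$ be proper lower semi-continuous convex, and let $G\colon\mathcal{H}_1\to\mathbb{R}$ and $F\colon\mathcal{H}_2\to\mathbb{R}$ be convex and continuously differentiable with Lipschitz continuous gradients. Consider the saddle point problem $$\min_{x\in\mathcal{H}_1}\max_{y\in\mathcal{H}_2}\ g(x)+G(x)+\langle Kx,y\rangle-f(y)-F(y),$$ assume it has a solution, where a solution means a pair $z=(x,y)$ with $0\in Az+Bz$ for $$A(x,y)=\big(\partial g(x)+K^*y,\ -Kx+\partial f(y)\big),\qquad B(x,y)=\big(\nabla G(x),\nabla F(y)\big),$$ and let $\beta>0$ be such that $B$ is $\beta$-co-coercive. Let $\mathcal{T}\in\mathcal{S}_{++}(\mathcal{H}_1)$ and $\Sigma\in\mathcal{S}_{++}(\mathcal{H}_2)$ be such that $$M_0:=\begin{pmatrix}\mathcal{T}^{-1}&-K^*\\-K&\Sigma^{-1}\end{pmatrix}\succ0,$$ let $\mathrm{s}\in\{-1,1\}$ and $M_k=M_0+\mathrm{s}U_kU_k^*$, where $U_k=\binom{U_{k,x}}{U_{k,y}}\colon\mathbb{R}^r\to\mathcal{H}_1\times\mathcal{H}_2$ is linear and injective. Let $(\epsilon_k)_{k\in\mathbb{N}}$,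 $\epsilon_k=(\epsilon_{k,x},\epsilon_{k,y})\in\mathcal{H}$, satisfy $\sum_k\|\epsilon_k\|<\infty$. (i) Suppose that $M_k\in\mathcal{S}_\sigma(\mathcal{H})$ for all $k$ and some $\sigma>0$, that $\sup_k\|M_k\|<\infty$, that there is $(\eta_k)_{k\in\mathbb{N}}\in\ell^1_+(\mathbb{N})$ with $(1+\eta_k)M_k\succeq M_{k+1}$ for all $k$, and that, for some $\kappa>0$, $M_k-\frac1{2\beta}\mathrm{Id}\in\mathcal{S}_\kappa(\mathcal{H})$ for all $k$. Let $z_k=(x_k,y_k)$ be generated from $z_{-1},z_0\in\mathcal{H}$ by Algorithm I (described in the context) with parameters $\alpha_k\in(0,\Lambda]$, $\Lambda<\infty$, such that $\sum_k\alpha_k\max\{\|z_k-z_{k-1}\|_{M_k},\|z_k-z_{k-1}\|_{M_k}^2\}<\infty$. Then $(x_k,y_k)$ converges weakly to some solution $z^*$ of the saddle point problem. Furthermore, if $g$ and $f$ are both strongly convex (or $G$ and $F$ are both strongly convex), $\epsilon_k=0$ for all $k$ and, for some $\kappa>0$, $M_k-\frac1\beta\mathrm{Id}\in\mathcal{S}_\kappa(\mathcal{H})$ for all $k$, then there exist $\xi\in(0,1)$, $\Theta>0$ and $K_0\in\mathbb{N}$ such that for every $k>K_0$ $$\|z_k-z^*\|_{M_k}^2\le(1-\xi)^{k-K_0}\|z_{K_0}-z^*\|_{M_{K_0}}^2+\sum_{i=K_0}^{k-1}\Theta(1-\xi)^{k-i}\alpha_i\max\{\|z_i-z_{i-1}\|_{M_i},\|z_i-z_{i-1}\|_{M_i}^2\}.$$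 (ii) Suppose that $M_k\in\mathcal{S}_\sigma(\mathcal{H})$ for all $k$ and some $\sigma>0$, that, for some $c>0$, $M_k-\frac1\beta\mathrm{Id}\in\mathcal{S}_c(\mathcal{H})$ for all $k$, and that $\sup_k\|M_k\|<\infty$. Let $z_k=(x_k,y_k)$ be generated from $z_0\in\mathcal{H}$ by Algorithm R (described in the context), with $\tilde z_k\ne z_k$ for all $k$. Then $(x_k,y_k)$ converges weakly to some solution of the saddle point problem. Furthermore, if $g$ and $f$ are both strongly convex (or $G$ and $F$ are both strongly convex) and $\epsilon_k=0$ for all $k$, then the convergence is linear: there exists $\xi\in(0,1)$ such that, with $z^*$ a solution, $\|z_k-z^*\|^2\le(1-\xi)^k\|z_0-z^*\|^2$ for all $k\in\mathbb{N}$.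
   Context: $\mathcal{S}(\mathcal{H})$ is the set of bounded self-adjoint linear operators; $U\succeq V$ means $\langle Ux,x\rangle\ge\langle Vx,x\rangle$ for all $x$; $\mathcal{S}_\sigma(\mathcal{H})=\{U\in\mathcal{S}(\mathcal{H}):U\succeq\sigma\,\mathrm{Id}\}$; $\mathcal{S}_{++}(\mathcal{H})=\{U\in\mathcal{S}(\mathcal{H}):U\succ0\}$, where $U\succ0$ means $U\succeq\sigma\,\mathrm{Id}$ for some $\sigma>0$. $\|x\|_M=\sqrt{\langle Mx,x\rangle}$. $\ell^1_+(\mathbb{N})$ is the set of summable sequences in $[0,\infty)$. $B$ is $\beta$-co-coercive if $\langle z-w,Bz-Bw\rangle\ge\beta\|Bz-Bw\|^2$ for all $z,w$. For $\mathcal{T}\in\mathcal{S}_{++}(\mathcal{H}_1)$, $\mathrm{prox}_g^{\mathcal{T}}(x)=(\mathrm{Id}+\mathcal{T}\partial g)^{-1}(x)=\mathrm{argmin}_{u}\,g(u)+\frac12\|u-x\|_{\mathcal{T}^{-1}}^2$; similarly $\mathrm{prox}_f^{\Sigma}$. For $\bar z=(\bar x,\bar y)\in\mathcal{H}$ and $\xi\in\mathbb{R}^r$ put $$X_k(\bar z,\xi)=\mathrm{prox}_g^{\mathcal{T}}(\bar x-\mathcal{T}\nabla G(\bar x)-\mathcal{T}K^*\bar y-\mathrm{s}\mathcal{T}U_{k,x}\xi),$$ $$\mathcal{J}_{k,\bar z}(\xi)=U_{k,x}^*[\bar x-X_k(\bar z,\xi)]+U_{k,y}^*\big[\bar y-\mathrm{prox}_f^{\Sigma}(\bar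 y-\Sigma\nabla F(\bar y)+\Sigma K(2X_k(\bar z,\xi)-\bar x)-\mathrm{s}\Sigma U_{k,y}\xi)\big]+\xi .$$ Algorithm I (inertial quasi-Newton PDHG): for $k=0,1,\dots$, $\bar x_k=x_k+\alpha_k(x_k-x_{k-1})$, $\bar y_k=y_k+\alpha_k(y_k-y_{k-1})$; with $\xi_k$ the root of $\mathcal{J}_{k,\bar z_k}$, $\bar z_k=(\bar x_k,\bar y_k)$, $$x_{k+1}=X_k(\bar z_k,\xi_k)+\epsilon_{k,x},\qquad y_{k+1}=\mathrm{prox}_f^{\Sigma}(\bar y_k-\Sigma\nabla F(\bar y_k)+\Sigma K(2x_{k+1}-\bar x_k)-\mathrm{s}\Sigma U_{k,y}\xi_k)+\epsilon_{k,y}.$$ Algorithm R (quasi-Newton PDHG with relaxation): for $k=0,1,\dots$, with $\xi_k$ the root of $\mathcal{J}_{k,z_k}$, $$\tilde x_k=X_k(z_k,\xi_k)+\epsilon_{k,x},\qquad \tilde y_k=\mathrm{prox}_f^{\Sigma}(y_k-\Sigma\nabla F(y_k)+\Sigma K(2\tilde x_k-x_k)-\mathrm{s}\Sigma U_{k,y}\xi_k)+\epsilon_{k,y},$$ $\tilde z_k=(\tilde x_k,\tilde y_k)$, $v_k=M_k(z_k-\tilde z_k)+B\tilde z_k-Bz_k$, $t_k=\frac{\langle z_k-\tilde z_k,v_k\rangle}{2\|v_k\|^2}$, $z_{k+1}=z_k-t_kv_k$. *)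

(* Defs.v *)
From HB Require Import structures.
From mathcomp Require Import all_boot all_order all_algebra.
From mathcomp Require Import all_classical all_reals all_analysis.
From mathcomp Require Import ring.

Set Implicit Arguments.
Unset Strict Implicit.
Unset Printing Implicit Defensive.

Import Order.TTheory GRing.Theory Num.Theory.
Import numFieldNormedType.Exports.

Local Open Scope classical_set_scope.
Local Open Scope ring_scope.

(* Definiteness of the inner product follows from [hdotxx]. *)
HB.mixin Record CompleteNormedModule_isHilbert (R : realType) H
    & CompleteNormedModule R H := {
  hdot : H -> H -> R ;
  hdotC : forall x y, hdot x y = hdot y x ;
  hdotDl : forall x y z, hdot (x + y) z = hdot x z + hdot y z ;
  hdotZl : forall (a : R) x y, hdot (a *: x) y = a * hdot x y ;
  hdotxx : forall x, hdot x x = `|x| ^+ 2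
}.

#[short(type="hilbertType")]
HB.structure Definition Hilbert (R : realType) :=
  {H of CompleteNormedModule_isHilbert R H & CompleteNormedModule R H}.

Section hilbert_theory.
Context {R : realType} {H : hilbertType R}.
Implicit Types x y z : H.

Lemma hdotDr x y z : hdot x (y + z) = hdot x y + hdot x z.
Proof. by rewrite hdotC hdotDl !(hdotC x). Qed.

Lemma hdotZr a x y : hdot x (a *: y) = a * hdot x y.
Proof. by rewrite hdotC hdotZl hdotC. Qed.

Lemma hdot0l x : hdot 0 x = 0.
Proof. by rewrite -(scale0r 0) hdotZl mul0r. Qed.

Lemma hdot_suml (I : Type) (s : seq I) (P : pred I) (F : I -> H) x :
  hdot (\sum_(i <- s | P i) F i) x = \sum_(i <- s | P i) hdot (F i) x.
Proof.
by elim/big_rec2: _ => [|i a b _ <-]; rewrite ?hdot0l ?hdotDl.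
Qed.

End hilbert_theory.

(* The normed-module structure that the library puts on [H1 * H2] is the one of
   the max norm; the alias [hprod] carries the norm
   sqrt (|x|^2 + |y|^2) of the inner product <x, x'> + <y, y'> instead. *)
Definition hprod (R : realType) (H1 H2 : hilbertType R) : Type :=
  (H1 * H2)%type.

Definition hpair (R : realType) (H1 H2 : hilbertType R) (x : H1) (y : H2) :
  hprod H1 H2 := (x, y).

Section hprod_instance.
Context {R : realType} {H1 H2 : hilbertType R}.

HB.instance Definition _ :=
  GRing.Lmodule.copy (hprod H1 H2) (H1 * H2)%type.

Implicit Types z w : hprod H1 H2.

Definition hprod_dot z w : R := hdot z.1 w.1 + hdot z.2 w.2.
Definition hprod_norm z : R := Num.sqrt (`|z.1| ^+ 2 + `|z.2| ^+ 2).

Lemma hprod_dotC z w : hprod_dot z w = hprod_dot w z.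
Proof. by rewrite /hprod_dot hdotC (hdotC z.2). Qed.

Lemma hprod_dotDl z1 z2 w :
  hprod_dot (z1 + z2) w = hprod_dot z1 w + hprod_dot z2 w.
Proof. by rewrite /hprod_dot !hdotDl addrACA. Qed.

Lemma hprod_dotZl (a : R) z w : hprod_dot (a *: z) w = a * hprod_dot z w.
Proof. by rewrite /hprod_dot !hdotZl mulrDr. Qed.

Lemma hprod_norm_ge0 z : 0 <= hprod_norm z.
Proof. exact: sqrtr_ge0. Qed.

Lemma sqr_hprod_norm z : hprod_norm z ^+ 2 = `|z.1| ^+ 2 + `|z.2| ^+ 2.
Proof. by rewrite sqr_sqrtr// addr_ge0// sqr_ge0. Qed.

Lemma hprod_dotxx z : hprod_dot z z = hprod_norm z ^+ 2.
Proof. by rewrite sqr_hprod_norm /hprod_dot !hdotxx. Qed.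

Lemma hprod_normZ (a : R) z : hprod_norm (a *: z) = `|a| * hprod_norm z.
Proof.
by rewrite /hprod_norm /= !normrZ !exprMn -mulrDr sqrtrM ?sqr_ge0// sqrtr_sqr
  normr_id.
Qed.

Lemma hprod_norm_eq0 z : hprod_norm z = 0 -> z = 0.
Proof.
move=> z0; have /eqP := sqr_hprod_norm z.
rewrite z0 expr0n/= eq_sym paddr_eq0 ?sqr_ge0// !sqrf_eq0 !normr_eq0.
by case: z {z0} => x y /= /andP[/eqP-> /eqP->].
Qed.

Lemma hprod_normD z w : hprod_norm (z + w) <= hprod_norm z + hprod_norm w.
Proof.
have n0 := (hprod_norm_ge0 z, hprod_norm_ge0 w).
rewrite -(ler_pXn2r (isT : (0 < 2)%N)) ?nnegrE ?hprod_norm_ge0 ?addr_ge0 ?n0//.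
rewrite sqrrD !sqr_hprod_norm /=.
set a := `|z.1|; set b := `|z.2|; set c := `|w.1|; set d := `|w.2|.
have [a0 b0 c0 d0] : [/\ 0 <= a, 0 <= b, 0 <= c & 0 <= d].
  by split; exact: normr_ge0.
have cs : a * c + b * d <= hprod_norm z * hprod_norm w.
  rewrite -(ler_pXn2r (isT : (0 < 2)%N)) ?nnegrE
    ?mulr_ge0 ?addr_ge0 ?mulr_ge0 ?n0//.
  rewrite exprMn !sqr_hprod_norm -/a -/b -/c -/d -subr_ge0.
  rewrite (_ : _ - _ = (a * d - b * c) ^+ 2) ?sqr_ge0//.
  by ring.
have h1 : `|z.1 + w.1| ^+ 2 <= (a + c) ^+ 2.
  by rewrite ler_pXn2r ?nnegrE ?addr_ge0//; exact: ler_normD.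
have h2 : `|z.2 + w.2| ^+ 2 <= (b + d) ^+ 2.
  by rewrite ler_pXn2r ?nnegrE ?addr_ge0//; exact: ler_normD.
apply: le_trans (lerD h1 h2) _; rewrite -subr_ge0.
rewrite (_ : _ - _ = (hprod_norm z * hprod_norm w - (a * c + b * d)) *+ 2).
  by rewrite mulrn_wge0// subr_ge0.
by rewrite !mulr2n; ring.
Qed.

HB.instance Definition _ := Lmodule_isNormed.Build R (hprod H1 H2)
  hprod_normD hprod_normZ hprod_norm_eq0.

Lemma ler_hprod_fst z : `|z.1| <= `|z|.
Proof.
rewrite -(ler_pXn2r (isT : (0 < 2)%N)) ?nnegrE//.
by rewrite [leRHS]sqr_hprod_norm lerDl sqr_ge0.
Qed.

Lemma ler_hprod_snd z : `|z.2| <= `|z|.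
Proof.
rewrite -(ler_pXn2r (isT : (0 < 2)%N)) ?nnegrE//.
by rewrite [leRHS]sqr_hprod_norm lerDr sqr_ge0.
Qed.

Lemma ler_hprodD z : `|z| <= `|z.1| + `|z.2|.
Proof.
rewrite -(ler_pXn2r (isT : (0 < 2)%N)) ?nnegrE ?addr_ge0//.
rewrite [leLHS]sqr_hprod_norm sqrrD -addrA lerD2l lerDr.
by rewrite mulrn_wge0 ?mulr_ge0.
Qed.

Lemma hprod_complete (F : set_system (hprod H1 H2)) :
  ProperFilter F -> cauchy F -> cvg F.
Proof.
move=> FF /cauchyP Fc.
have c1 : cvg ((fst : hprod H1 H2 -> H1) @ F).
  apply: cauchy_cvg; apply/cauchyP => e e0.
  have [z Fz] := Fc _ e0; exists z.1.
  apply: (@filterS _ F _ (ball z e)) Fz => w.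
  rewrite -!ball_normE /=; apply: le_lt_trans; exact: (ler_hprod_fst (z - w)).
have c2 : cvg ((snd : hprod H1 H2 -> H2) @ F).
  apply: cauchy_cvg; apply/cauchyP => e e0.
  have [z Fz] := Fc _ e0; exists z.2.
  apply: (@filterS _ F _ (ball z e)) Fz => w.
  rewrite -!ball_normE /=; apply: le_lt_trans; exact: (ler_hprod_snd (z - w)).
apply/cvg_ex; exists (hpair (lim ((fst : hprod H1 H2 -> H1) @ F))
                            (lim ((snd : hprod H1 H2 -> H2) @ F))).
apply/cvgrPdist_lt => e e0; have e20 : 0 < e / 2 by rewrite divr_gt0.
move/cvgrPdist_lt : c1 => /(_ _ e20) h1.
move/cvgrPdist_lt : c2 => /(_ _ e20) h2.
apply: filterS2 h1 h2 => w /= h1 h2.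
by rewrite (le_lt_trans (ler_hprodD _))// [e]splitr ltrD.
Qed.

HB.instance Definition _ :=
  Uniform_isComplete.Build (hprod H1 H2) hprod_complete.

HB.instance Definition _ := CompleteNormedModule_isHilbert.Build R
  (hprod H1 H2) hprod_dotC hprod_dotDl hprod_dotZl hprod_dotxx.

End hprod_instance.

Section operators.
Context {R : realType}.
Implicit Types H : hilbertType R.

(* For a bounded linear phi the vector exists and is unique; the default 0 is
   never used for the functionals below. *)
Definition riesz H (phi : H -> R) : H :=
  xget 0 [set v | forall h, phi h = hdot v h].

Definition adjoint H H' (K : H -> H') (y : H') : H :=
  riesz (fun x => hdot (K x) y).

(* The adjoint of an operator on the Euclidean space R^r; see
   [euclid_adjointE]. *)
Definition euclid_adjoint (r : nat) H (U : 'cV[R]_r -> H) (z : H) : 'cV[R]_r :=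
  \col_i hdot (U (delta_mx i 0)) z.

Lemma euclid_adjointE (r : nat) H (U : {linear 'cV[R]_r -> H}) xi z :
  hdot (U xi) z = \sum_i xi i 0 * euclid_adjoint U z i 0.
Proof.
rewrite [xi in LHS]matrix_sum_delta linear_sum hdot_suml.
by apply: eq_bigr => i _; rewrite big_ord1 linearZ hdotZl mxE.
Qed.

Definition succeq H (U V : H -> H) : Prop :=
  forall x, hdot (V x) x <= hdot (U x) x.

Definition succ0 H (U : H -> H) : Prop :=
  exists2 sigma : R, 0 < sigma & succeq U (fun x => sigma *: x).

(* The classes S(H), S_sigma(H) and S_++(H) are [bounded_selfadjoint],
   [Sge sigma] and [Spp]. *)
Definition bounded_selfadjoint H (U : H -> H) : Prop :=
  [/\ linear U, continuous U & forall x y, hdot (U x) y = hdot x (U y)].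

Definition Sge H (sigma : R) (U : H -> H) : Prop :=
  bounded_selfadjoint U /\ succeq U (fun x => sigma *: x).

Definition Spp H (U : H -> H) : Prop := bounded_selfadjoint U /\ succ0 U.

Definition opnorm H (U : H -> H) : R :=
  sup [set `|U x| | x in [set x | `|x| <= 1]].

Definition normM H (M : H -> H) (x : H) : R := Num.sqrt (hdot (M x) x).

Definition cocoercive H (beta : R) (B : H -> H) : Prop :=
  forall z w, beta * `|B z - B w| ^+ 2 <= hdot (z - w) (B z - B w).

Definition weakly_cvg H (z : nat -> H) (l : H) : Prop :=
  forall w, hdot (z k) w @[k --> \oo] --> hdot l w.

Definition summable_nneg (eta : nat -> R) : Prop :=
  (forall k, 0 <= eta k) /\ cvgn (series eta).

End operators.

Section convex_analysis.
Context {R : realType} {H : hilbertType R}.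
Implicit Types (g : H -> \bar R) (G : H -> R).

Definition proper_efun g : Prop :=
  (forall x, g x != -oo%E) /\ (exists x, g x != +oo%E).

(* With 0 * +oo = 0, the cases t = 0 and t = 1 carry no information. *)
Definition convex_efun g : Prop :=
  forall (x y : H) (t : R), 0 <= t <= 1 ->
    (g (t *: x + (1 - t) *: y)%R <= t%:E * g x + (1 - t)%:E * g y)%E.

Definition strongly_convex g : Prop :=
  exists2 m : R, 0 < m &
  forall (x y : H) (t : R), 0 <= t <= 1 ->
    (g (t *: x + (1 - t) *: y)%R
       + (m / 2 * (t * (1 - t)) * `|x - y| ^+ 2)%:E
     <= t%:E * g x + (1 - t)%:E * g y)%E.

Definition subdifferential g (x : H) : set H :=
  [set u | forall y, (g x + (hdot u (y - x)%R)%:E <= g y)%E].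

(* The resolvent (Id + T o subdifferential g)^-1; it is single-valued and
   everywhere defined for T in S_++(H) and g proper, lsc and convex. *)
Definition prox (T : H -> H) g (x : H) : H :=
  xget 0 [set p | exists2 u, subdifferential g p u & x = p + T u].

Definition gradient G (x : H) : H := riesz ('d G x).

Definition C1_lipschitz_gradient G : Prop :=
  [/\ forall x, differentiable G x,
      continuous (gradient G) & lipschitz (gradient G)].

End convex_analysis.

Section pdhg.
Context {R : realType} {H1 H2 : hilbertType R} {r : nat}.
Variables (K : H1 -> H2) (g : H1 -> \bar R) (f : H2 -> \bar R).
Variables (G : H1 -> R) (F : H2 -> R).

Definition saddleA (z : hprod H1 H2) : set (hprod H1 H2) :=
  [set a | exists u v, [/\ subdifferential g z.1 u, subdifferential f z.2 v
    & a = hpair (u + adjoint K z.2) (- K z.1 + v)]].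

Definition saddleB (z : hprod H1 H2) : hprod H1 H2 :=
  hpair (gradient G z.1) (gradient F z.2).

Definition saddle_solution (z : hprod H1 H2) : Prop :=
  exists2 a, saddleA z a & a + saddleB z = 0.

Variables (T : H1 -> H1) (Sigma : H2 -> H2) (s : R).

(* [pinv setT T] is the inverse of T: operators in S_++ are bijective. *)
Definition metric0 (z : hprod H1 H2) : hprod H1 H2 :=
  hpair (pinv setT T z.1 - adjoint K z.2) (- K z.1 + pinv setT Sigma z.2).

Definition metric (U : 'cV[R]_r -> hprod H1 H2) (z : hprod H1 H2) :
  hprod H1 H2 := metric0 z + s *: U (euclid_adjoint U z).

Definition pdhg_x (U : 'cV[R]_r -> hprod H1 H2) (zb : hprod H1 H2)
    (xi : 'cV[R]_r) : H1 :=
  prox T g (zb.1 - T (gradient G zb.1) - T (adjoint K zb.2)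
            - s *: T (U xi).1).

(* [x] stands for the value of the primal variable that is extrapolated. *)
Definition pdhg_y (U : 'cV[R]_r -> hprod H1 H2) (zb : hprod H1 H2)
    (x : H1) (xi : 'cV[R]_r) : H2 :=
  prox Sigma f (zb.2 - Sigma (gradient F zb.2)
                + Sigma (K (2%:R *: x - zb.1)) - s *: Sigma (U xi).2).

Definition pdhg_J (U : 'cV[R]_r -> hprod H1 H2) (zb : hprod H1 H2)
    (xi : 'cV[R]_r) : 'cV[R]_r :=
  let X := pdhg_x U zb xi in
  euclid_adjoint (fun e => (U e).1) (zb.1 - X)
  + euclid_adjoint (fun e => (U e).2) (zb.2 - pdhg_y U zb X xi) + xi.

(* z_{k-1}, where [zm1] is z_{-1} *)
Definition previous (zm1 : hprod H1 H2) (z : nat -> hprod H1 H2) (k : nat) :=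
  if k is k'.+1 then z k' else zm1.

Definition inertial_pdhg (U : nat -> 'cV[R]_r -> hprod H1 H2)
    (alpha : nat -> R) (eps : nat -> hprod H1 H2) (zm1 : hprod H1 H2)
    (z : nat -> hprod H1 H2) (xi : nat -> 'cV[R]_r) : Prop :=
  forall k, let zb := z k + alpha k *: (z k - previous zm1 z k) in
  [/\ pdhg_J (U k) zb (xi k) = 0,
      (z k.+1).1 = pdhg_x (U k) zb (xi k) + (eps k).1
    & (z k.+1).2 = pdhg_y (U k) zb (z k.+1).1 (xi k) + (eps k).2].

Definition relaxed_pdhg (U : nat -> 'cV[R]_r -> hprod H1 H2)
    (eps : nat -> hprod H1 H2) (z zt : nat -> hprod H1 H2)
    (xi : nat -> 'cV[R]_r) : Prop :=
  forall k,
  let v := metric (U k) (z k - zt k) + saddleB (zt k) - saddleB (z k) in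
  let t := hdot (z k - zt k) v / (2 * `|v| ^+ 2) in
  [/\ pdhg_J (U k) (z k) (xi k) = 0,
      (zt k).1 = pdhg_x (U k) (z k) (xi k) + (eps k).1,
      (zt k).2 = pdhg_y (U k) (z k) (zt k).1 (xi k) + (eps k).2
    & z k.+1 = z k - t *: v].

End pdhg.

(* Main.v *)
(* A step of the algorithms is a resolvent step: at the root of J_k, the pair
   zh of proximal points computed from the (extrapolated) point zb satisfies
   M_k (zb - zh) - B zb \in A zh.
   (i) Monotonicity of A and cocoercivity of B make |z_k - z|_{M_k} quasi-Fejer
   monotone for each zero z of A + B, and the residuals zb_k - zh_k and
   B zb_k - B z vanish.  As A is maximal monotone (A + M_0 is inverted by two
   proximal steps), weak cluster points of z_k are zeros; Opial's argument, in
   which M_k converges strongly because it is quasi-decreasing, yields weak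
   convergence.
   (ii) v_k is up to the errors in (A + B) zt_k, so that z_{k+1} is a relaxed
   projection of z_k onto a half-space containing all zeros, whence quasi-Fejer
   monotonicity in the norm of H.
   Riesz representation, inverses of operators in S_++ and existence of
   proximal points all come from minimizing g(p) + <Sp, p> / 2 - <w, p>; weak
   compactness comes from ultrafilters. *)
Require Import Defs.
From HB Require Import structures.
From mathcomp Require Import all_boot all_order all_algebra.
From mathcomp Require Import all_classical all_reals all_analysis.
From mathcomp Require Import ring lra.

Set Implicit Arguments.
Unset Strict Implicit.
Unset Printing Implicit Defensive.

Import Order.TTheory GRing.Theory Num.Theory.
Import numFieldNormedType.Exports.

Local Open Scope classical_set_scope.
Local Open Scope ring_scope.

(** * Forms and limits in Hilbert spaces *)

(** Both algorithms are compared with [zh], the step without errors. An error in x also enters the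
    second proximal point, through K; Lipschitz continuity of the proximal map bounds the whole
    deviation by a fixed multiple of |eps_k|. Such errors are additive in a norm, so the Fejer
    inequalities are arranged for norms and not for squared norms.

    Since B is evaluated at zb and A at zh, a cross term 2 <zb - zh, B zb - B z> remains. Young's
    inequality splits it between M_k and the term 2 <zb - z, B zb - B z> given by monotonicity. If
    that term may be spent entirely through cocoercivity, M_k > 1 / (2 beta) suffices. If M_k >= 1 /
    beta, half of it is left over, and strong monotonicity of B turns that half into a rate. In
    (ii), 1 / beta enters as the Lipschitz constant of B.

    The moduli [mA] and [mB] of strong monotonicity may be zero, so that one set of estimates serves
    both weak convergence and linear rates. *)

Section linear_predicate.
Context {R : realType} {V W : normedModType R} (f : V -> W).
Hypothesis lf : linear f.

Lemma linear_predD x y : f (x + y) = f x + f y.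
Proof. by have := lf 1 x y; rewrite !scale1r. Qed.

Lemma linear_pred0 : f 0 = 0.
Proof. by apply: (@addrI _ (f 0)); rewrite -linear_predD !addr0. Qed.

Lemma linear_predZ a x : f (a *: x) = a *: f x.
Proof. by have := lf a x 0; rewrite linear_pred0 !addr0. Qed.

Lemma linear_predN x : f (- x) = - f x.
Proof. by rewrite -scaleN1r linear_predZ scaleN1r. Qed.

Lemma linear_predB x y : f (x - y) = f x - f y.
Proof. by rewrite linear_predD linear_predN. Qed.

Lemma linear_pred_bounded :
  continuous f -> exists2 L : R, 0 < L & forall x, `|f x| <= L * `|x|.
Proof.
move=> cf; pose h : {linear V -> W} :=
  HB.pack f (GRing.isLinear.Build _ _ _ _ f lf).
have : bounded_near h (nbhs 0) by apply: continuous_linear_bounded; exact: cf.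
by move=> /linear_boundedP /pinfty_ex_gt0[L L0 hL]; exists L.
Qed.

Lemma linear_bound_continuous (L : R) :
  (forall x, `|f x| <= L * `|x|) -> continuous f.
Proof.
move=> fL; pose h : {linear V -> W} :=
  HB.pack f (GRing.isLinear.Build _ _ _ _ f lf).
suff : continuous h by [].
apply/bounded_linear_continuous/linear_boundedP.
near=> r => x; rewrite (le_trans (fL x))// ler_wpM2r//.
Unshelve. all: by end_near. Qed.

End linear_predicate.

Section hilbert_basics.
Context {R : realType} {H : hilbertType R}.
Implicit Types x y z : H.

Lemma hdotNl x y : hdot (- x) y = - hdot x y.
Proof. by rewrite -scaleN1r hdotZl mulN1r. Qed.

Lemma hdotNr x y : hdot x (- y) = - hdot x y.
Proof. by rewrite hdotC hdotNl hdotC. Qed.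

Lemma hdotBl x y z : hdot (x - y) z = hdot x z - hdot y z.
Proof. by rewrite hdotDl hdotNl. Qed.

Lemma hdotBr x y z : hdot x (y - z) = hdot x y - hdot x z.
Proof. by rewrite hdotDr hdotNr. Qed.

Definition hdotE :=
  (@hdotDl R H, @hdotDr R H, @hdotZl R H, @hdotZr R H, hdotNl, hdotNr).

End hilbert_basics.

Section coercive_form.
Context {R : realType} {H : hilbertType R} (M : H -> H) (sigma : R).
Hypotheses (linM : linear M) (symM : forall x y, hdot (M x) y = hdot x (M y)).
Hypothesis sigma0 : 0 < sigma.
Hypothesis coerM : forall x, sigma * `|x| ^+ 2 <= hdot (M x) x.

Lemma form_ge0 x : 0 <= hdot (M x) x.
Proof. by rewrite (le_trans _ (coerM x))// mulr_ge0 ?sqr_ge0// ltW. Qed.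

Lemma sqr_normM x : normM M x ^+ 2 = hdot (M x) x.
Proof. by rewrite sqr_sqrtr// form_ge0. Qed.

Lemma normM_ge0 x : 0 <= normM M x. Proof. exact: sqrtr_ge0. Qed.

Lemma normM_gt0 x : x != 0 -> 0 < normM M x.
Proof.
move=> x0; rewrite sqrtr_gt0 (lt_le_trans _ (coerM x))//.
by rewrite mulr_gt0// exprn_gt0// normr_gt0.
Qed.

(** Positivity of the form at [normM M y *: x - normM M x *: y]; the common factor 2 |x|_M |y|_M can
    be cancelled once both vectors are nonzero. *)
Lemma form_cauchy_schwarz x y : hdot (M x) y <= normM M x * normM M y.
Proof.
have [->|x0] := eqVneq x 0.
  by rewrite (linear_pred0 linM) hdot0l mulr_ge0 ?normM_ge0.
have [->|y0] := eqVneq y 0.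
  by rewrite hdotC hdot0l mulr_ge0 ?normM_ge0.
have nx := normM_gt0 x0; have ny := normM_gt0 y0.
have := form_ge0 (normM M y *: x - normM M x *: y).
rewrite (linear_predB linM) !(linear_predZ linM) !hdotE.
rewrite (symM y x) (hdotC y) -!sqr_normM => h.
have : 0 <= 2 * (normM M x * normM M y)
    * (normM M x * normM M y - hdot (M x) y) by lra.
by rewrite pmulr_rge0 ?subr_ge0// !mulr_gt0.
Qed.

Lemma form_expand x y : hdot (M (x + y)) (x + y)
  = hdot (M x) x + 2 * hdot (M x) y + hdot (M y) y.
Proof.
by rewrite (linear_predD linM) !hdotE (symM y x) (hdotC y (M x)); ring.
Qed.

Lemma ler_normMD x y : normM M (x + y) <= normM M x + normM M y.
Proof.
rewrite -(ler_pXn2r (isT : (0 < 2)%N)) ?nnegrE ?addr_ge0 ?normM_ge0//.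
rewrite sqr_normM form_expand sqrrD -!sqr_normM.
by have := form_cauchy_schwarz x y; lra.
Qed.

Lemma normMZ (a : R) x : 0 <= a -> normM M (a *: x) = a * normM M x.
Proof.
move=> a0; rewrite /normM (linear_predZ linM) hdotZl hdotZr mulrA -expr2.
by rewrite sqrtrM ?sqr_ge0// sqrtr_sqr ger0_norm.
Qed.

End coercive_form.

Section hilbert_norm.
Context {R : realType} {H : hilbertType R}.
Implicit Types x y z : H.

Lemma sqr_normD x y : `|x + y| ^+ 2 = `|x| ^+ 2 + 2 * hdot x y + `|y| ^+ 2.
Proof. by rewrite -!hdotxx !hdotE (hdotC y x); ring. Qed.

Lemma sqr_normB x y : `|x - y| ^+ 2 = `|x| ^+ 2 - 2 * hdot x y + `|y| ^+ 2.
Proof. by rewrite -!hdotxx !hdotE (hdotC y x); ring. Qed.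

Lemma hdot_ge0 x : 0 <= hdot x x. Proof. by rewrite hdotxx sqr_ge0. Qed.

Lemma cauchy_schwarz x y : hdot x y <= `|x| * `|y|.
Proof.
have normE z : normM id z = `|z| by rewrite /normM hdotxx sqrtr_sqr normr_id.
rewrite -2!normE.
apply: (@form_cauchy_schwarz _ _ id 1) => // z; by rewrite mul1r hdotxx.
Qed.

Lemma cauchy_schwarz_abs x y : `|hdot x y| <= `|x| * `|y|.
Proof.
rewrite ler_norml cauchy_schwarz andbT lerNl -hdotNl.
by rewrite (le_trans (cauchy_schwarz _ _))// normrN.
Qed.

Lemma hdot_ext x y : (forall z, hdot x z = hdot y z) -> x = y.
Proof.
move=> h; apply/eqP; rewrite -subr_eq0 -normr_eq0 -sqrf_eq0 -hdotxx.
by rewrite {1}hdotBl h subrr.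
Qed.

Lemma sqr_norm_le_twice x y : `|x + y| ^+ 2 <= 2 * (`|x| ^+ 2 + `|y| ^+ 2).
Proof. by have := sqr_ge0 `|x - y|; rewrite sqr_normB sqr_normD; lra. Qed.

End hilbert_norm.

Section weak_limits.
Context {R : realType} {H : hilbertType R}.

(** [weakly_cvg] along an arbitrary filter: cluster points are taken along ultrafilters instead of
    subsequences. *)
Definition wcvg {I : Type} (F : set_system I) (z : I -> H) (l : H) : Prop :=
  forall w, hdot (z k) w @[k --> F] --> hdot l w.

Context {I : Type} {F : set_system I} {FF : Filter F}.
Implicit Types z b : I -> H.

Lemma hdot_cvg0 (C : R) z b : (forall k, `|z k| <= C) ->
  b @ F --> (0 : H) -> hdot (z k) (b k) @[k --> F] --> 0.
Proof.
move=> zC b0; have bn : `|b k| @[k --> F] --> 0.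
  by rewrite -(@normr0 _ H); exact: cvg_norm.
have bC : C * `|b k| @[k --> F] --> 0.
  by rewrite -(mulr0 C); apply: cvgMr.
apply: (@squeeze_cvgr _ _ _ _ (fun k => - (C * `|b k|))
  (fun k => C * `|b k|)) => //.
  apply: nearW => k; rewrite -ler_norml (le_trans (cauchy_schwarz_abs _ _))//.
  by rewrite ler_wpM2r.
by rewrite -oppr0; exact: cvgN.
Qed.

Lemma wcvg_strong z l : z @ F --> l -> wcvg F z l.
Proof.
move=> zl w.
suff h : hdot w (z k - l) @[k --> F] --> 0.
  have -> : (fun k => hdot (z k) w) = (fun k => hdot w (z k - l) + hdot l w).
    by apply/funext => k; rewrite hdotBr !(hdotC w) subrK.
  by rewrite -[X in _ --> X]add0r; apply: cvgD => //; exact: cvg_cst.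
apply: (hdot_cvg0 (C := `|w|)) => //.
by rewrite -(subrr l); apply: cvgB => //; exact: cvg_cst.
Qed.

(** The bound on z is a hypothesis because weak convergence along a general filter does not imply
    boundedness. *)
Lemma wcvg_hdot (C : R) z l b m : (forall k, `|z k| <= C) ->
  wcvg F z l -> b @ F --> m -> hdot (z k) (b k) @[k --> F] --> hdot l m.
Proof.
move=> zC zl bb.
have -> : (fun k => hdot (z k) (b k))
    = (fun k => hdot (z k) (b k - m) + hdot (z k) m).
  by apply/funext => k; rewrite -hdotDr subrK.
rewrite -[X in _ --> X]add0r; apply: cvgD; last exact: zl.
apply: (hdot_cvg0 (C := C)) => //.
by rewrite -(subrr m); apply: cvgB => //; exact: cvg_cst.
Qed.

Lemma wcvgD z b l l' : wcvg F z l -> wcvg F b l' ->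
  wcvg F (fun k => z k + b k) (l + l').
Proof.
move=> zl bl w; rewrite hdotDl.
under eq_fun do rewrite hdotDl.
by apply: cvgD; [exact: zl|exact: bl].
Qed.

End weak_limits.

(** * Elliptic inclusions and proximal points *)

(** The limit t -> 0 by hand: if X < 0, the chosen t makes t * c at most - X / 2. It extracts
    first-order conditions from convexity along a segment. *)
Lemma ge0_of_affine (R : realType) (X c : R) :
  (forall t, 0 < t < 1 -> 0 <= X + t * c) -> 0 <= X.
Proof.
move=> h; rewrite leNgt; apply/negP => X0.
pose t := Num.min (1 / 2) (- X / (2 * (`|c| + 1))).
have c1 : 0 < 2 * (`|c| + 1) by rewrite mulr_gt0// ltr_wpDl.
have t0 : 0 < t by rewrite lt_min divr_gt0//= divr_gt0// oppr_gt0.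
have t1 : t < 1 by rewrite gt_min; apply/orP; left; lra.
have := h t; rewrite t0 t1 => /(_ isT).
have : t * c <= t * (`|c| + 1).
  by rewrite ler_pM2l// (le_trans (ler_norm _))// lerDl.
have : t <= - X / (2 * (`|c| + 1)) by rewrite ge_min lexx orbT.
rewrite ler_pdivlMr// => ? ? ?; lra.
Qed.

Lemma cvg_of_sqr_dist (R : realType) (V : completeNormedModType R)
    (u : nat -> V) (e : nat -> R) :
  e @ \oo --> 0 -> (forall n m, (n <= m)%N -> `|u n - u m| ^+ 2 <= e n) ->
  cvgn u.
Proof.
move=> e0 ue; apply: cauchy_cvg; apply: cauchy_exP => d d0.
have [N _ hN] := cvgr_lt _ e0 _ (exprn_gt0 2 d0); exists (u N).
exists N => // m /= Nm; rewrite -ball_normE /=.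
rewrite -(ltr_pXn2r (isT : (0 < 2)%N)) ?nnegrE ?normr_ge0// ?(ltW d0)//.
by rewrite (le_lt_trans (ue _ _ Nm))// hN/=.
Qed.

Section elliptic_inclusion.
Context {R : realType} {H : hilbertType R}.
Variables (S : H -> H) (sigma : R) (g : H -> \bar R) (w : H).
Hypotheses (linS : linear S) (symS : forall x y, hdot (S x) y = hdot x (S y)).
Hypotheses (sigma0 : 0 < sigma).
Hypothesis coerS : forall x, sigma * `|x| ^+ 2 <= hdot (S x) x.
Hypotheses (gprop : proper_efun g) (glsc : lower_semicontinuous g).
Hypothesis gconv : convex_efun g.

Let q p : R := 2^-1 * hdot (S p) p - hdot w p.

Let q_line p h t :
  q (p + t *: h) = q p + t * hdot (S p - w) h + t ^+ 2 * (2^-1 * hdot (S h) h).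
Proof.
rewrite /q (linear_predD linS) (linear_predZ linS) !hdotE.
rewrite (symS h p) (hdotC h (S p)).
lra.
Qed.

Let fing x : g x != +oo%E -> g x = (fine (g x))%:E.
Proof. by move=> gx; rewrite fineK// fin_numE gx (gprop.1 x). Qed.

Let conv_fine x y t : g x != +oo%E -> g y != +oo%E -> 0 <= t <= 1 ->
  (g (t *: x + (1 - t) *: y)%R
    <= (t * fine (g x) + (1 - t) * fine (g y))%R%:E)%E.
Proof.
move=> gx gy t01; apply: (le_trans (gconv _ _ t01)).
by rewrite {1}(fing gx) {1}(fing gy) -!EFinM -EFinD.
Qed.

(** Stands in for a continuous affine minorant without any separation theorem: semicontinuity bounds
    g below on a ball around [x0], and convexity along rays from [x0] spreads the bound with linear
    loss. *)
Let linear_minorant : exists a b, 0 <= b /\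
  forall y, g y != +oo%E -> a - b * `|y| <= fine (g y).
Proof.
have [x0 gx0] := gprop.2.
have [|V] := @glsc x0 (fine (g x0) - 1).
  by rewrite {2}(fing gx0) lte_fin; lra.
move=> /nbhs_ballP[d /= d0 dV] gV.
exists (fine (g x0) - 1 - 2 / d * `|x0|), (2 / d).
split; first by rewrite divr_ge0// ltW.
move=> y gy.
suff : fine (g x0) - 1 - 2 / d * `|y - x0| <= fine (g y).
  have : 2 / d * `|y - x0| <= 2 / d * (`|y| + `|x0|).
    apply: ler_wpM2l; first by rewrite divr_ge0// ltW.
    by rewrite -(normrN x0) ler_normD.
  lra.
have [yd|yd] := ltP `|y - x0| d.
  have := gV y; rewrite (fing gy) lte_fin => /(_ _)/ltW h.
  have := h (dV y _); rewrite -ball_normE /= distrC => /(_ yd).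
  have : 0 <= 2 / d * `|y - x0| by rewrite mulr_ge0 ?divr_ge0// ltW.
  lra.
have n0 : 0 < `|y - x0| by rewrite (lt_le_trans d0).
(* This t puts the point x0 + t (y - x0) at distance d / 2 from x0, inside the ball; hence the slope
   2 / d. *)
pose t := d / (2 * `|y - x0|).
have t0 : 0 < t by rewrite divr_gt0// mulr_gt0.
have t1 : t <= 1 by rewrite ler_pdivrMr ?mulr_gt0//; lra.
have t01 : 0 <= t <= 1 by rewrite ltW.
have := conv_fine gy gx0 t01.
have := gV (t *: y + (1 - t) *: x0).
have -> : t *: y + (1 - t) *: x0 = x0 + t *: (y - x0).
  by rewrite scalerBl scale1r scalerBr addrCA addrA.
move=> /(_ _) h /(lt_le_trans (h _)).
have {}h : V (x0 + t *: (y - x0)).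
  apply: dV; rewrite -ball_normE /= opprD addrA subrr sub0r normrN normrZ.
  rewrite gtr0_norm// /t invfM mulrA mulfVK ?gt_eqF//; lra.
move=> /(_ h); rewrite lte_fin => {}h.
have /ler_pM2l <- := t0.
have tn : t * `|y - x0| = d / 2 by rewrite /t invfM mulrA mulfVK// gt_eqF.
have -> : t * (fine (g x0) - 1 - 2 / d * `|y - x0|)
  = t * fine (g x0) - t - 2 / d * (t * `|y - x0|) by ring.
rewrite tn; have -> : 2 / d * (d / 2) = 1 by field; rewrite gt_eqF.
lra.
Qed.

(** Direct method: coercivity of S makes every minimizing sequence of [Q] Cauchy, so the minimizer
    is a strong limit and no weak compactness is involved. *)
Lemma elliptic_inclusion : exists p, subdifferential g p (w - S p).
Proof.
have [a [b [b0 minor]]] := linear_minorant.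
pose Q p := fine (g p) + q p.
pose E := [set Q p | p in [set p | g p != +oo%E]].
have [x0 gx0] := gprop.2.
(* The minimum over |p| of sigma / 2 |p|^2 - (b + |w|) |p|, found by completing the square. *)
have Elb : lbound E (a - (b + `|w|) ^+ 2 / (2 * sigma)).
  move=> _ [p gp <-]; rewrite /Q /q.
  have := minor _ gp; have := coerS p; have := cauchy_schwarz w p.
  have : 0 <= (sigma * `|p| - (b + `|w|)) ^+ 2 / (2 * sigma).
    by rewrite divr_ge0 ?sqr_ge0// mulr_ge0// ltW.
  have -> : (sigma * `|p| - (b + `|w|)) ^+ 2 / (2 * sigma) =
    2^-1 * (sigma * `|p| ^+ 2) - (b + `|w|) * `|p|
    + (b + `|w|) ^+ 2 / (2 * sigma) by field; rewrite gt_eqF.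
  lra.
have Einf : has_inf E.
  by split; [exists (Q x0), x0|exists (a - (b + `|w|) ^+ 2 / (2 * sigma))].
have infE p : g p != +oo%E -> inf E <= Q p.
  by move=> gp; apply: ge_inf; [exact: Einf.2|exists p].
have /choice[p hp] : forall n, exists p,
    g p != +oo%E /\ Q p < inf E + n.+1%:R^-1.
  move=> n; have n0 : 0 < n.+1%:R^-1 :> R by rewrite invr_gt0.
  by have [_ [p gp <-] ?] := inf_adherent n0 Einf; exists p.
(* Parallelogram argument: the midpoint has value at least [inf E], while the quadratic part gains
   an eighth of the form at p n - p m over the mean of the two values. *)
have mid n m : sigma / 8 * `|p n - p m| ^+ 2
    <= (Q (p n) + Q (p m)) / 2 - inf E.
  have h01 : 0 <= (2^-1 : R) <= 1 by apply/andP; split; lra.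
  have := conv_fine (hp n).1 (hp m).1 h01.
  have -> : 1 - 2^-1 = 2^-1 :> R by lra.
  have -> : 2^-1 *: p n + 2^-1 *: p m = p m + 2^-1 *: (p n - p m).
    rewrite scalerBr addrCA; congr (_ + _).
    by rewrite -{2}(scale1r (p m)) -scalerBl; congr (_ *: _); lra.
  set c := _ + _ *: _ => gc.
  have gcf : g c != +oo%E by rewrite -ltey (le_lt_trans gc)// ltey.
  have := infE _ gcf; move: gc; rewrite {1}(fing gcf) lee_fin.
  rewrite /Q (q_line (p m) (p n - p m) 2^-1 : q c = _).
  have := coerS (p n - p m).
  have -> : q (p n) = q (p m + 1 *: (p n - p m)).
    by rewrite scale1r addrCA subrr addr0.
  rewrite q_line; lra.
have pcvg : cvgn p.
  apply: (@cvg_of_sqr_dist _ _ _ (fun n => 8 / sigma * n.+1%:R^-1)).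
    rewrite -[X in _ --> X](mulr0 (8 / sigma)); apply: cvgMr.
    exact: cvg_harmonic.
  move=> n m nm; rewrite -ler_pdivrMl ?divr_gt0// invf_div.
  have := mid n m; have := (hp n).2; have := (hp m).2.
  have : m.+1%:R^-1 <= n.+1%:R^-1 :> R by rewrite lef_pV2 ?posrE// ler_nat.
  move: (n.+1%:R^-1) (m.+1%:R^-1) (Q (p n)) (Q (p m)) => hn hm Qn Qm; lra.
move/cvg_ex : pcvg => [l pl].
have lw : hdot (p n - l) (S l - w) @[n --> \oo] --> 0.
  rewrite -(subrr (hdot l (S l - w))).
  under eq_fun do rewrite hdotBl.
  by apply: cvgB; [exact: wcvg_strong|exact: cvg_cst].
(* Semicontinuity is tested on reals a' below [g l], so that it applies before [g l] is known to be
   finite; finiteness and minimality of [l] both follow from it. *)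
have gle a' : (a'%:E < g l)%E -> a' <= inf E - q l.
  move=> /glsc[V Vl gV].
  have pV : \forall n \near \oo, V (p n) by apply: pl.
  have cv : (inf E + n.+1%:R^-1) - q l - hdot (p n - l) (S l - w)
      @[n --> \oo] --> inf E - q l.
    rewrite -[X in _ --> X]subr0; apply: cvgB => //; apply: cvgB.
      rewrite -[X in _ --> X]addr0; apply: cvgD; first exact: cvg_cst.
      exact: cvg_harmonic.
    exact: cvg_cst.
  apply: (cvgr_to_ge cv).
  near=> n.
  have : (a'%:E < g (p n))%E by apply: gV; near: n.
  rewrite (fing (hp n).1) lte_fin.
  have := (hp n).2; rewrite /Q.
  have -> : q (p n) = q (l + 1 *: (p n - l)).
    by rewrite scale1r addrCA subrr addr0.
  rewrite q_line expr1n !mul1r (hdotC (S l - w)).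
  have := coerS (p n - l); have : 0 <= sigma * `|p n - l| ^+ 2.
    by rewrite mulr_ge0 ?sqr_ge0// ltW.
  move: (n.+1%:R^-1) => hn; lra.
have gl : g l != +oo%E.
  apply/negP => /eqP gl; have := gle (inf E - q l + 1).
  by rewrite gl ltry => /(_ isT); lra.
have Ql : Q l <= inf E.
  rewrite /Q leNgt; apply/negP => h.
  pose a' := (inf E - q l + fine (g l)) / 2.
  have := gle a'; rewrite (fing gl) lte_fin /a'; lra.
exists l => y.
have [gy|gy] := eqVneq (g y) +oo%E; first by rewrite gy leey.
rewrite (fing gl) (fing gy) lee_fin -subr_ge0.
(* Minimality of [l] compared with l + t (y - l), divided by t: the quadratic remainder is the slope
   in t and vanishes in the limit. *)
apply: (@ge0_of_affine _ _ (2^-1 * hdot (S (y - l)) (y - l))) => t /andP[t0 t1].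
have t01 : 0 <= t <= 1 by rewrite !ltW.
have := conv_fine gy gl t01.
have -> : t *: y + (1 - t) *: l = l + t *: (y - l).
  by rewrite scalerBl scale1r scalerBr addrCA addrA.
set c := _ + _ *: _ => gc.
have gcf : g c != +oo%E by rewrite -ltey (le_lt_trans gc)// ltey.
have := infE _ gcf; move: gc; rewrite {1}(fing gcf) lee_fin.
have := Ql; rewrite /Q (q_line l (y - l) t : q c = _) !hdotE => h1 h2 h3.
rewrite -(pmulr_rge0 _ t0); lra.
Unshelve. all: by end_near. Qed.

End elliptic_inclusion.

(** * Riesz representation, adjoints, inverses and proximal points *)

Section riesz_theory.
Context {R : realType} {H : hilbertType R}.

(** With g = phi, S = id and w = 0 the minimizer p satisfies <- p, h> <= phi h for all h; changing h
    to - h gives equality. *)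
Lemma rieszE (phi : H -> R) : linear (phi : H -> R^o) -> continuous phi ->
  forall h, phi h = hdot (riesz phi) h.
Proof.
move=> lphi cphi.
have [|||||||p sp] := @elliptic_inclusion R H id 1 (EFin \o phi) 0.
- by [].
- by [].
- by [].
- by move=> x; rewrite mul1r hdotxx.
- by split=> [//|]; exists 0.
- move=> x a; rewrite lte_fin => ax; exists [set y | a < phi y].
    exact: (cvgr_gt (phi x) (cphi x) _ ax).
  by move=> y; rewrite lte_fin.
- move=> x y t t01; rewrite /= -!EFinM -EFinD lee_fin.
  by rewrite (linear_predD lphi) !(linear_predZ lphi).
have spE h : hdot (- p) h <= phi h.
  have := sp (p + h); rewrite /= -EFinD lee_fin sub0r (addrC p) addrK.
  by rewrite (linear_predD lphi); lra.
rewrite /riesz; case: xgetP => [v -> //|/(_ (- p))[]] h.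
apply/eqP; rewrite eq_le spE andbT.
by have := spE (- h); rewrite hdotNr (linear_predN lphi) lerN2.
Qed.

End riesz_theory.

Section adjoint_theory.
Context {R : realType} {H H' : hilbertType R} (K : {linear H -> H'}).
Hypothesis cK : continuous K.

Lemma adjointE y x : hdot (adjoint K y) x = hdot (K x) y.
Proof.
rewrite -rieszE//.
- by move=> a u v; rewrite linearP hdotDl hdotZl.
- by move=> u; apply: wcvg_strong; exact: cK.
Qed.

Lemma linear_adjoint : linear (adjoint K).
Proof.
move=> a y y'; apply: hdot_ext => x.
by rewrite hdotDl hdotZl !adjointE hdotDr hdotZr.
Qed.

End adjoint_theory.

Section posdef_inverse.
Context {R : realType} {H : hilbertType R} (T : H -> H).
Hypothesis T_Spp : Spp T.

Let linT : linear T := let: conj (And3 l _ _) _ := T_Spp in l.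

(** Surjectivity of T is the elliptic inclusion with g = 0: testing at p + (x - T p) forces x - T p
    = 0. *)
Lemma Spp_pinvK x : T (pinv setT T x) = x.
Proof.
have [[lT cT sT] [sigma s0 T_coer]] := T_Spp.
have coer y : sigma * `|y| ^+ 2 <= hdot (T y) y.
  by rewrite -hdotxx -hdotZl; exact: T_coer.
have [|||||||p sp] := @elliptic_inclusion R H T sigma (cst 0%E) x.
- by [].
- by [].
- by [].
- by [].
- by split=> [//|]; exists 0.
- by move=> y a ay; exists setT => //; exact: filterT.
- by move=> y y' t t01; rewrite /= !mule0 adde0.
apply: pinvK; rewrite inE; exists p => //.
apply/eqP; rewrite eq_sym -subr_eq0 -normr_eq0 -sqrf_eq0 -hdotxx eq_le hdot_ge0.
have := sp (p + (x - T p)).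
by rewrite /= add0e lee_fin (addrC p) addrK => ->.
Qed.

Lemma Spp_inj : injective T.
Proof.
have [[lT cT sT] [sigma s0 T_coer]] := T_Spp.
move=> x y Txy; apply/eqP; rewrite -subr_eq0 -normr_eq0 -sqrf_eq0.
have := T_coer (x - y); rewrite (linear_predB linT) Txy subrr hdot0l.
by rewrite hdotZl hdotxx pmulr_rle0// => h; rewrite eq_le h sqr_ge0.
Qed.

Lemma Spp_pinvKV x : pinv setT T (T x) = x.
Proof. by apply: Spp_inj; rewrite Spp_pinvK. Qed.

Lemma linear_Spp_pinv : linear (pinv setT T).
Proof.
by move=> a x y; apply: Spp_inj; rewrite Spp_pinvK linT !Spp_pinvK.
Qed.

Lemma Spp_pinv_sym x y : hdot (pinv setT T x) y = hdot x (pinv setT T y).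
Proof.
have [[lT cT sT] _] := T_Spp.
by rewrite -{1}(Spp_pinvK y) -sT Spp_pinvK.
Qed.

(** For x = T u, <u, T u> >= sigma |u|^2 and |x| <= L |u|, whence the constant sigma / L^2. *)
Lemma Spp_pinv_coercive :
  exists2 c : R, 0 < c & forall x, c * `|x| ^+ 2 <= hdot (pinv setT T x) x.
Proof.
have [[lT cT sT] [sigma s0 T_coer]] := T_Spp.
have [L L0 TL] := linear_pred_bounded lT cT.
exists (sigma / L ^+ 2) => [|x]; first by rewrite divr_gt0 ?exprn_gt0.
set u := pinv setT T x; have <- : T u = x by exact: Spp_pinvK.
rewrite (hdotC u); apply: le_trans (T_coer u).
rewrite hdotZl hdotxx -mulrA ler_pM2l// ler_pdivrMl ?exprn_gt0// -exprMn.
by rewrite ler_pXn2r ?nnegrE ?mulr_ge0// ltW.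
Qed.

(** The elliptic inclusion for the inverse of T yields a proximal point, so the default of [xget] is
    never taken. Writing the argument as [T w] loses nothing, T being onto, and it is the form in
    which the algorithms call [prox]. *)
Lemma proxP (g : H -> \bar R) : proper_efun g -> lower_semicontinuous g ->
  convex_efun g -> forall w,
  exists2 u, subdifferential g (prox T g (T w)) u & T w = prox T g (T w) + T u.
Proof.
move=> pg lg cg w; rewrite /prox; case: xgetP => [p _ //|].
have [c c0 coer] := Spp_pinv_coercive.
have [p sp] := elliptic_inclusion w linear_Spp_pinv Spp_pinv_sym c0 coer
  pg lg cg.
move=> /(_ p)[]; exists (w - pinv setT T p) => //.
by rewrite (linear_predB linT) Spp_pinvK addrC subrK.
Qed.

End posdef_inverse.

(** * Monotonicity of subdifferentials and gradients *)

Section subdifferential_theory.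
Context {R : realType} {H : hilbertType R} (g : H -> \bar R).
Hypothesis gprop : proper_efun g.

Lemma subdifferential_fin x u : subdifferential g x u ->
  g x = (fine (g x))%:E.
Proof.
have [y gy] := gprop.2; move=> /(_ y); have := gprop.1 x.
by case: (g x) => //= _; rewrite addye// leye_eq (negbTE gy).
Qed.

(** A subgradient inequality at x improves by m / 2 |y - x|^2: compare it with strong convexity on
    the segment, divide by t and let t -> 0. Adding the two improved inequalities gives modulus m; m
    = 0 is plain monotonicity. *)
Lemma subdifferential_strong_monotone (m : R) : 0 <= m ->
  (forall x y t, 0 <= t <= 1 ->
    (g (t *: x + (1 - t) *: y)%R
       + (m / 2 * (t * (1 - t)) * `|x - y| ^+ 2)%:E
     <= t%:E * g x + (1 - t)%:E * g y)%E) ->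
  forall x y u v, subdifferential g x u -> subdifferential g y v ->
  m * `|x - y| ^+ 2 <= hdot (x - y) (u - v).
Proof.
move=> m0 sg.
have half x y u v : subdifferential g x u -> subdifferential g y v ->
    m / 2 * `|y - x| ^+ 2 <= fine (g y) - fine (g x) - hdot u (y - x).
  move=> gx gy; rewrite -subr_ge0.
  apply: (@ge0_of_affine _ _ (m / 2 * `|y - x| ^+ 2)) => t /andP[t0 t1].
  have t01 : 0 <= t <= 1 by rewrite !ltW.
  have := sg y x t t01; have := gx (t *: y + (1 - t) *: x).
  have -> : t *: y + (1 - t) *: x - x = t *: (y - x).
    rewrite scalerBl scale1r scalerBr -!addrA; congr (_ + _).
    by rewrite addrCA subrr addr0.
  rewrite (subdifferential_fin gx) (subdifferential_fin gy).
  rewrite -!EFinM -!EFinD.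
  case: (g _) (gprop.1 (t *: y + (1 - t) *: x)) => //= r _.
  rewrite !lee_fin hdotZr => h1 h2.
  rewrite -(pmulr_rge0 _ t0); lra.
move=> x y u v gx gy; have := half _ _ _ _ gx gy; have := half _ _ _ _ gy gx.
rewrite (distrC y) !hdotE (hdotC x v) (hdotC y v) (hdotC x u) (hdotC y u).
lra.
Qed.

Lemma subdifferential_monotone : convex_efun g ->
  forall x y u v, subdifferential g x u -> subdifferential g y v ->
  0 <= hdot (x - y) (u - v).
Proof.
move=> cg x y u v gu gv; rewrite -[leLHS](mul0r (`|x - y| ^+ 2)).
apply: subdifferential_strong_monotone gu gv => // x' y' t t01.
by rewrite !mul0r adde0; exact: cg.
Qed.

End subdifferential_theory.

Section gradient_theory.
Context {R : realType} {H : hilbertType R} (G : H -> R).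
Hypothesis dG : forall x, differentiable G x.

Lemma gradientE x h : hdot (gradient G x) h = 'd G x h.
Proof.
rewrite /gradient -rieszE//.
- by move=> a u v; rewrite linearP.
- exact: diff_continuous.
Qed.

Lemma strongly_convex_gradient : strongly_convex (EFin \o G) ->
  exists2 m : R, 0 < m & forall x y,
    m * `|x - y| ^+ 2 <= hdot (x - y) (gradient G x - gradient G y).
Proof.
move=> [m m0 sG]; exists m => //.
have half x y :
    m / 2 * `|y - x| ^+ 2 <= G y - G x - hdot (gradient G x) (y - x).
  have /cvg_dnbhs_at_right cd := @diff_derivable _ _ _ G x (y - x) (dG x).
  rewrite -/(derive G x (y - x)) deriveE// -gradientE in cd.
  suff : hdot (gradient G x) (y - x) <= G y - G x - m / 2 * `|y - x| ^+ 2.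
    lra.
  (* Strong convexity bounds the difference quotient of G at x in direction y - x by this expression
     for 0 < t <= 1; the limit at 0+ gives the improved gradient inequality. *)
  have cm : G y - G x - m / 2 * (1 - t) * `|y - x| ^+ 2 @[t --> (0 : R)^'+]
      --> G y - G x - m / 2 * `|y - x| ^+ 2.
    apply: cvg_at_right_filter; rewrite -[in X in _ --> X](mulr1 (m / 2)).
    apply: cvgB; first exact: cvg_cst.
    apply: cvgMl; apply: cvgMr; rewrite -[X in _ --> X]subr0.
    by apply: cvgB; [exact: cvg_cst|exact: cvg_id].
  apply: (ler_cvg_to cd cm); near=> t.
  have t0 : 0 < t by near: t; exact: nbhs_right_gt.
  have t01 : 0 <= t <= 1.
    by rewrite ltW//; near: t; exact: nbhs_right_le.
  have := sG y x t t01; rewrite /= -!EFinM -!EFinD lee_fin.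
  have -> : t *: y + (1 - t) *: x = t *: (y - x) + x.
    by rewrite scalerBl scale1r scalerBr addrCA addrC.
  move=> h; rewrite /GRing.scale /= ler_pdivrMl//; lra.
move=> x y; have := half x y; have := half y x.
rewrite (distrC y) -(opprB x y) hdotNr (hdotC (gradient G x)).
rewrite (hdotC (gradient G y)) [hdot _ (_ - _)]hdotBr.
move: (hdot _ (gradient G x)) (hdot _ (gradient G y)) (`|_|) => a b n; lra.
Unshelve. all: by end_near. Qed.

End gradient_theory.

(** * Weak compactness and Fejer sequences *)

Section ultrafilter_limits.

Lemma ultra_fmap_cluster (I : Type) (T : topologicalType) (F : set_system I)
    (f : I -> T) (l : T) : UltraFilter F -> cluster (f @ F) l -> f @ F --> l.
Proof.
move=> FU cl V Vl; have [//|FnV] := in_ultra_setVsetC (f @^-1` V) FU.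
by have [x [/= nVx Vx]] := cl (~` V) V FnV Vl.
Qed.

(** A filter is the intersection of the ultrafilters above it: if the preimage of V is not in F,
    some ultrafilter above F contains its complement. *)
Lemma cvg_of_ultra (I : Type) (T : topologicalType) (F : set_system I)
    (f : I -> T) (l : T) : Filter F ->
  (forall G : set_system I, UltraFilter G -> F `<=` G -> f @ G --> l) ->
  f @ F --> l.
Proof.
move=> FF h V Vl; apply: contrapT => FV.
have pW : ProperFilter (within (~` (f @^-1` V)) F).
  split; last exact: within_filter FF.
  move=> W0; apply: FV.
  by apply: (@filterS _ F FF _ _ _ W0) => x /= nV; apply: contrapT => /nV.
have [G [GU GW]] := ultraFilterLemma pW.
have FG : F `<=` G.
  by move=> A FA; apply: GW; apply: (@filterS _ F FF _ _ _ FA).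
have GnV : G (~` (f @^-1` V)) by apply: GW; exact: withinT.
have GV : G (f @^-1` V) := h G GU FG V Vl.
have [x [/= Vx nVx]] := filter_ex (filterI GV GnV).
exact: nVx.
Qed.

Context {R : realType} {H : hilbertType R}.

(** For each w the inner products stay in a compact segment and so converge along F; the limits form
    a bounded linear functional of w, represented by Riesz. *)
Lemma wcvg_ultra (I : Type) (F : set_system I) (z : I -> H) (C : R) :
  UltraFilter F -> (forall k, `|z k| <= C) -> exists l, wcvg F z l.
Proof.
move=> FU zC.
have zwC w k : `|hdot (z k) w| <= C * `|w|.
  by rewrite (le_trans (cauchy_schwarz_abs _ _))// ler_wpM2r.
have /choice[phi hphi] : forall w, exists c : R, hdot (z k) w @[k --> F] --> c.
  move=> w.
  have [|c [_ cl]] := @segment_compact R (- (C * `|w|)) (C * `|w|)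
    (hdot (z k) w @[k --> F]) _.
    by apply: nearW => k; rewrite /= in_itv /= -ler_norml.
  by exists c; exact: ultra_fmap_cluster.
have lphi : linear (phi : H -> R^o).
  move=> a u v; apply: (cvg_unique _ (hphi (a *: u + v))) => //.
  have -> : (fun k => hdot (z k) (a *: u + v))
      = (fun k => a * hdot (z k) u + hdot (z k) v).
    by apply/funext => k; rewrite hdotDr hdotZr.
  by apply: cvgD; [apply: cvgMr; exact: hphi|exact: hphi].
have phiC w : `|phi w| <= C * `|w|.
  rewrite ler_norml; apply/andP; split.
    apply: (cvgr_to_ge (hphi w)); apply: nearW => k.
    by have := zwC w k; rewrite ler_norml => /andP[].
  apply: (cvgr_to_le (hphi w)); apply: nearW => k.
  by have := zwC w k; rewrite ler_norml => /andP[].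
exists (riesz phi) => w; rewrite -rieszE//.
exact: (linear_bound_continuous lphi phiC).
Qed.

(** The last hypothesis separates cluster points: two of them have the same inner product c with d,
    the strong limit of [D k]. A varying [D] is what a variable metric requires. *)
Lemma opial (z : nat -> H) (C : R) (Sol : set H) :
  (forall k, `|z k| <= C) ->
  (forall G : set_system nat, UltraFilter G -> \oo `<=` G ->
    forall l, wcvg G z l -> Sol l) ->
  (forall z1 z2, Sol z1 -> Sol z2 -> exists (D : nat -> H) (d : H) (c : R),
    [/\ D @ \oo --> d, hdot (z k) (D k) @[k --> \oo] --> c
      & hdot (z1 - z2) d = 0 -> z1 = z2]) ->
  exists2 l, Sol l & weakly_cvg z l.
Proof.
move=> zC cluster_sol sep.
have [U [UU oU]] := ultraFilterLemma (eventually_filter : ProperFilter \oo).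
have [l zl] := wcvg_ultra UU zC.
have Sl := cluster_sol _ UU oU _ zl.
exists l => // w; apply: cvg_of_ultra => G GU oG.
have [l' zl'] := wcvg_ultra GU zC.
suff -> : l = l' by exact: zl'.
have [D [d [c [Dd zc]]]] := sep _ _ Sl (cluster_sol _ GU oG _ zl').
apply; rewrite hdotBl.
have DU : D @ U --> d by apply: cvg_trans Dd; exact: cvg_app.
have DG : D @ G --> d by apply: cvg_trans Dd; exact: cvg_app.
have zU : hdot (z k) (D k) @[k --> U] --> c.
  by apply: cvg_trans zc; exact: cvg_app.
have zG : hdot (z k) (D k) @[k --> G] --> c.
  by apply: cvg_trans zc; exact: cvg_app.
have -> : hdot l d = c by apply: (cvg_unique _ (wcvg_hdot zC zl DU) zU).
have -> : hdot l' d = c by apply: (cvg_unique _ (wcvg_hdot zC zl' DG) zG).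
by rewrite subrr.
Qed.

End ultrafilter_limits.

(** * Quasi-Fejer sequences and quasi-decreasing operators *)

Section quasi_fejer.
Context {R : realType}.
Implicit Types eta delta a : nat -> R.

Lemma prod1D_ge1 eta k : (forall k, 0 <= eta k) ->
  1 <= \prod_(i < k) (1 + eta i).
Proof.
move=> eta0; elim/big_rec: _ => // i x _ x1.
by rewrite -[leLHS]mulr1 ler_pM// lerDl.
Qed.

Lemma cvg_prod1D eta : summable_nneg eta ->
  cvgn (fun k => \prod_(i < k) (1 + eta i)).
Proof.
move=> [eta0 /cvg_ex[/= s es]]; apply: nondecreasing_is_cvgn.
  apply/nondecreasing_seqP => k; rewrite big_ord_recr /= ler_peMr ?lerDl//.
  by rewrite (le_trans ler01)// prod1D_ge1.
exists (expR s) => _ [k _ <-].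
apply: (@le_trans _ _ (expR (series eta k))).
  rewrite /series /= big_mkord; elim: k => [|k IH].
    by rewrite !big_ord0 expR0.
  rewrite !big_ord_recr /= expRD ler_pM ?expR_ge1Dx ?addr_ge0//.
  by rewrite (le_trans ler01)// prod1D_ge1.
rewrite ler_expR.
have := nondecreasing_cvgn_le _ (cvgP _ es) k; rewrite (cvg_lim _ es)//; apply.
by apply: nondecreasing_series.
Qed.

Lemma quasi_fejer_cvg a eta delta : (forall k, 0 <= a k) ->
  summable_nneg eta -> summable_nneg delta ->
  (forall k, a k.+1 <= (1 + eta k) * (a k + delta k)) -> cvgn a.
Proof.
move=> a0 etaS [delta0 deltaS] ha.
have [eta0 _] := etaS.
pose P k := \prod_(i < k) (1 + eta i).
have P1 k : 1 <= P k by exact: prod1D_ge1.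
have P0 k : 0 < P k by rewrite (lt_le_trans ltr01).
(* Dividing by the product removes the factors 1 + eta k, and subtracting the partial sums removes
   the errors, as P k >= 1. What is left decreases and is bounded below. *)
pose b k := a k / P k - series delta k.
have bcvg : cvgn b.
  have /cvg_ex[/= s es] := deltaS.
  apply: nonincreasing_is_cvgn.
    apply/nonincreasing_seqP => k; rewrite /b seriesEnat /= big_nat_recr//=.
    move: (\sum_(0 <= i < k) delta i) => S.
    suff : a k.+1 / P k.+1 <= a k / P k + delta k by lra.
    rewrite ler_pdivrMr// /P big_ord_recr /= -/(P k).
    apply: (le_trans (ha k)).
    rewrite mulrA mulrC ler_wpM2r ?addr_ge0//; last first.
      by rewrite mulrDl divfK ?gt_eqF// lerD2l ler_peMr.
  exists (- s) => _ [k _ <-]; rewrite /b lerBrDr addrC.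
  apply: (@le_trans _ _ 0); last by rewrite divr_ge0// ltW.
  rewrite subr_le0; have := nondecreasing_cvgn_le _ deltaS k.
  by rewrite (cvg_lim _ es)//; apply; exact: nondecreasing_series.
have -> : a = (fun k => P k * (b k + series delta k)).
  by apply/funext => k; rewrite /b subrK mulrC divfK// gt_eqF.
apply: is_cvgM; first exact: cvg_prod1D.
exact: (is_cvgD bcvg deltaS).
Qed.

End quasi_fejer.

Section decreasing_operators.
Context {R : realType} {H : hilbertType R}.

(** Positivity of the form at x - D x / C, a substitute for the square root of D. *)
Lemma sqr_norm_le_form (D : H -> H) (C : R) : linear D ->
  (forall x y, hdot (D x) y = hdot x (D y)) -> 0 < C ->
  (forall x, 0 <= hdot (D x) x <= C * `|x| ^+ 2) ->
  forall x, `|D x| ^+ 2 <= C * hdot (D x) x.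
Proof.
move=> lD sD C0 DC x.
have /andP[_ h1] := DC (D x).
have /andP[h0 _] := DC (x - C^-1 *: D x).
move: h0; rewrite (linear_predB lD) (linear_predZ lD) !hdotE hdotxx.
rewrite (sD (D x) x) hdotxx.
have h2 : C^-1 * (C^-1 * hdot (D (D x)) (D x)) <= C^-1 * `|D x| ^+ 2.
  by rewrite ler_pM2l ?invr_gt0// ler_pdivrMl.
move=> h3; have : C^-1 * `|D x| ^+ 2 <= hdot (D x) x by lra.
by rewrite ler_pdivrMl.
Qed.

(** After division by [P k] the forms decrease. [sqr_norm_le_form], applied to the difference of two
    of them, bounds the squared distance of the images of d by C times a difference of the
    convergent real sequence [q]. *)
Lemma quasi_decreasing_cvg (M : nat -> H -> H) (eta : nat -> R) (C : R) :
  (forall k, linear (M k)) ->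
  (forall k x y, hdot (M k x) y = hdot x (M k y)) -> 0 < C ->
  (forall k x, 0 <= hdot (M k x) x <= C * `|x| ^+ 2) ->
  summable_nneg eta ->
  (forall k x, hdot (M k.+1 x) x <= (1 + eta k) * hdot (M k x) x) ->
  forall d, cvgn (fun k => M k d).
Proof.
move=> lM sM C0 MC etaS hM d.
have [eta0 _] := etaS.
pose P k := \prod_(i < k) (1 + eta i).
have P1 k : 1 <= P k by exact: prod1D_ge1.
have P0 k : 0 < P k by rewrite (lt_le_trans ltr01).
have PM x n m : (n <= m)%N ->
    (P m)^-1 * hdot (M m x) x <= (P n)^-1 * hdot (M n x) x.
  apply: (@nonincreasing_seqP _ R (fun k => (P k)^-1 * hdot (M k x) x)).1 => k.
  rewrite ler_pdivrMl// /P big_ord_recr /= -/(P k).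
  by rewrite [P k * _]mulrC -mulrA mulVKf ?gt_eqF.
pose q k := (P k)^-1 * hdot (M k d) d.
have /cvg_ex[/= q0 qq] : cvgn q.
  apply: nonincreasing_is_cvgn; first by move=> n m; exact: PM.
  exists 0 => _ [k _ <-]; rewrite mulr_ge0 ?invr_ge0 ?(ltW (P0 k))//.
  by have /andP[] := MC k d.
have Ncvg : cvgn (fun k => (P k)^-1 *: M k d).
  apply: (@cvg_of_sqr_dist _ _ _ (fun n => C * (q n - q0))).
    rewrite -[X in _ --> X](mulr0 C); apply: cvgMr.
    by rewrite -(subrr q0); apply: cvgB => //; exact: cvg_cst.
  move=> n m nm.
  pose D x := (P n)^-1 *: M n x - (P m)^-1 *: M m x.
  apply: (@le_trans _ _ (C * hdot (D d) d)).
    apply: (@sqr_norm_le_form D) => //.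
    - move=> a u v; rewrite /D !lM !scalerDr !scalerN !scalerA.
      by rewrite !(mulrC a) opprD addrACA.
    - by move=> x y; rewrite /D !hdotE !sM.
    move=> x; rewrite /D !hdotE subr_ge0 PM//=.
    rewrite lerBlDr; apply: (@le_trans _ _ (hdot (M n x) x)).
      have /andP[h _] := MC n x.
      by rewrite ler_piMl// invf_le1.
    have /andP[_ h] := MC n x; apply: (le_trans h).
    rewrite lerDl mulr_ge0 ?invr_ge0 ?(ltW (P0 m))//.
    by have /andP[] := MC m x.
  rewrite ler_pM2l// /D !hdotE lerB// -/(q m).
  have := nonincreasing_cvgn_ge _ (cvgP _ qq) m; rewrite (cvg_lim _ qq)//.
  by apply => i j; exact: PM.
have -> : (fun k => M k d) = (fun k => P k *: ((P k)^-1 *: M k d)).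
  by apply/funext => k; rewrite scalerA mulfV ?scale1r// gt_eqF.
by apply: is_cvgZ => //; exact: cvg_prod1D.
Qed.

End decreasing_operators.

Section real_limits.
Context {R : realType}.

Lemma cvg0_of_le {I : Type} (F : set_system I) {FF : Filter F} (u w : I -> R) :
  (forall k, 0 <= u k <= w k) -> w @ F --> 0 -> u @ F --> 0.
Proof.
move=> uw w0; apply: (@squeeze_cvgr _ _ _ _ (fun=> 0) w) => //.
  exact: nearW.
exact: cvg_cst.
Qed.

Lemma cvg0_of_sqr_norm_le {I : Type} {V : normedModType R}
    (F : set_system I) {FF : Filter F} (x : I -> V) (u : I -> R) (c : R) :
  0 < c -> (forall k, c * `|x k| ^+ 2 <= u k) -> u @ F --> 0 ->
  x @ F --> (0 : V).
Proof.
move=> c0 xu u0.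
have h : `|x k| ^+ 2 @[k --> F] --> 0.
  apply: (@cvg0_of_le _ _ _ _ (fun k => c^-1 * u k)).
    by move=> k; rewrite sqr_ge0/= ler_pdivlMl.
  by rewrite -(mulr0 c^-1); apply: cvgMr.
apply/cvgr0Pnorm_lt => e e0.
apply: (@filterS _ F FF _ _ _ (cvgr_lt _ h _ (exprn_gt0 2 e0))) => k /=.
by rewrite ltr_pXn2r ?nnegrE// ltW.
Qed.

Lemma cvg0_of_norm_le {I : Type} {V : normedModType R}
    (F : set_system I) {FF : Filter F} (x : I -> V) (u : I -> R) :
  (forall k, `|x k| <= u k) -> u @ F --> 0 -> x @ F --> (0 : V).
Proof.
move=> xu u0; apply/cvgr0Pnorm_lt => e e0.
apply: (@filterS _ F FF _ _ _ (cvgr_lt _ u0 _ e0)) => k /=.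
exact: le_lt_trans.
Qed.

Lemma cvgn_ubound (a : nat -> R) :
  cvgn a -> exists2 c, 0 < c & forall k, a k <= c.
Proof.
move=> /cvg_seq_bounded[c [_ hc]]; exists (`|c| + 1); first by rewrite ltr_wpDl.
move=> k; apply: (le_trans (ler_norm _)); apply: hc => //.
by rewrite ltr_pwDr// ler_norm.
Qed.

Lemma summable_nnegD (a b : nat -> R) :
  summable_nneg a -> summable_nneg b -> summable_nneg (fun k => a k + b k).
Proof.
move=> [a0 aS] [b0 bS]; split=> [k|]; first by rewrite addr_ge0.
exact: (is_cvg_seriesD aS bS).
Qed.

Lemma summable_nnegZ (c : R) (a : nat -> R) : 0 <= c ->
  summable_nneg a -> summable_nneg (fun k => c * a k).
Proof.
move=> c0 [a0 aS]; split=> [k|]; first by rewrite mulr_ge0.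
have -> : series (fun k => c * a k) = fun n => c * series a n.
  by apply/funext => n; rewrite /series /= mulr_sumr.
by apply: is_cvgM => //; exact: is_cvg_cst.
Qed.

Lemma summable_nneg_le (a b : nat -> R) : (forall k, 0 <= a k <= b k) ->
  cvgn (series b) -> summable_nneg a.
Proof.
move=> ab bS; have a0 k : 0 <= a k by have /andP[] := ab k.
have ab' k : a k <= b k by have /andP[] := ab k.
split=> //; apply: series_le_cvg bS => // k; exact: le_trans (ab' k).
Qed.

Lemma summable_nneg_cvg0 (a : nat -> R) : summable_nneg a -> a @ \oo --> 0.
Proof. by move=> [_ /cvg_series_cvg_0]. Qed.

Lemma summable_nneg0 : summable_nneg (fun=> 0 : R).
Proof.
split=> //; apply/cvg_ex; exists 0.
have -> : series (fun=> 0 : R) = fun=> 0.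
  by apply/funext => n; rewrite /series /= big1.
exact: cvg_cst.
Qed.

End real_limits.

(** * Forward-backward iterations *)

Section monotone_inclusion.
Context {R : realType} {H : hilbertType R}.
Variables (A : H -> set H) (B : H -> H) (beta mA mB : R).
Hypotheses (beta0 : 0 < beta) (B_coco : cocoercive beta B).
Hypotheses (mA0 : 0 <= mA) (mB0 : 0 <= mB).
Hypothesis A_mono : forall z a z' a', A z a -> A z' a' ->
  mA * `|z - z'| ^+ 2 <= hdot (z - z') (a - a').
Hypothesis B_mono : forall z w, mB * `|z - w| ^+ 2 <= hdot (z - w) (B z - B w).
Hypothesis A_max : forall z w,
  (forall z' a', A z' a' -> 0 <= hdot (z - z') (w - a')) -> A z w.

Lemma cocoercive_ge0 z w : 0 <= hdot (z - w) (B z - B w).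
Proof. by apply: le_trans (B_coco z w); rewrite mulr_ge0 ?sqr_ge0// ltW. Qed.

Lemma cocoercive_lipschitz z w : `|B z - B w| <= beta^-1 * `|z - w|.
Proof.
have [->|Bzw] := eqVneq (B z) (B w).
  by rewrite subrr normr0 mulr_ge0// invr_ge0 ltW.
have n0 : 0 < `|B z - B w| by rewrite normr_gt0 subr_eq0.
rewrite ler_pdivlMl// -(ler_pM2r n0) -mulrA -expr2.
exact: le_trans (B_coco z w) (cauchy_schwarz _ _).
Qed.

(** With d = zb - zh and e = zh - zs, monotonicity of A bounds <M d, e> from below, and that is the
    cross term in the expansion of the form at d + e. *)
Lemma forward_backward_step (M : H -> H) zb zh zs : linear M ->
  (forall x y, hdot (M x) y = hdot x (M y)) ->
  A zh (M (zb - zh) - B zb) -> A zs (- B zs) ->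
  hdot (M (zh - zs)) (zh - zs) + 2 * mA * `|zh - zs| ^+ 2
    + hdot (M (zb - zh)) (zb - zh) + 2 * hdot (zb - zs) (B zb - B zs)
  <= hdot (M (zb - zs)) (zb - zs) + 2 * hdot (zb - zh) (B zb - B zs).
Proof.
move=> lM sM Azh Azs; have := A_mono Azh Azs.
have -> : M (zb - zh) - B zb - - B zs = M (zb - zh) - (B zb - B zs).
  by rewrite opprK opprB addrA addrAC.
have -> : zb - zs = (zb - zh) + (zh - zs) by rewrite addrA subrK.
rewrite (form_expand lM sM (zb - zh)).
set e := zh - zs; set d := zb - zh; set D := B zb - B zs.
rewrite hdotBr (hdotC e (M d)) (hdotDl d e).
by move: (`|e| ^+ 2) (hdot _ _) (hdot _ _) (hdot _ _) (hdot _ _) (hdot _ _);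
  intros; lra.
Qed.

Lemma forward_backward_decrease (kappa : R) : 0 < kappa ->
  exists2 rho, 0 < rho & forall (M : H -> H) zb zh zs, linear M ->
    (forall x y, hdot (M x) y = hdot x (M y)) ->
    (forall x, (1 / (2 * beta) + kappa) * `|x| ^+ 2 <= hdot (M x) x) ->
    A zh (M (zb - zh) - B zb) -> A zs (- B zs) ->
    hdot (M (zh - zs)) (zh - zs) + kappa / 2 * `|zb - zh| ^+ 2
      + rho * `|B zb - B zs| ^+ 2
    <= hdot (M (zb - zs)) (zb - zs).
Proof.
move=> kappa0; have b20 : 0 < 1 / (2 * beta) by rewrite divr_gt0// mulr_gt0.
(* Young's weight, strictly between 1 / (2 beta) and the coercivity constant: kappa / 2 of the
   latter survives, and so does 2 beta - 1 / c > 0 of the cocoercivity term. Both are uniform in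
   M. *)
pose c := 1 / (2 * beta) + kappa / 2.
have c0 : 0 < c by rewrite addr_gt0// divr_gt0.
exists (2 * beta - c^-1).
  rewrite subr_gt0 -[ltRHS]invrK ltf_pV2 ?posrE ?invr_gt0 ?mulr_gt0//.
  by rewrite /c div1r ltrDl divr_gt0.
move=> M zb zh zs lM sM coerM Azh Azs.
have := forward_backward_step lM sM Azh Azs.
have := coerM (zb - zh); have := B_coco zb zs.
have := cauchy_schwarz (zb - zh) (B zb - B zs).
set d := zb - zh; set D := B zb - B zs.
have : 0 <= c^-1 * (c * `|d| - `|D|) ^+ 2.
  by rewrite mulr_ge0 ?sqr_ge0 ?invr_ge0 ?(ltW c0).
have -> : c^-1 * (c * `|d| - `|D|) ^+ 2
  = c * `|d| ^+ 2 - 2 * (`|d| * `|D|) + c^-1 * `|D| ^+ 2.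
  by field; rewrite gt_eqF.
have : 0 <= mA * `|zh - zs| ^+ 2 by rewrite mulr_ge0 ?sqr_ge0.
rewrite /c => h1 h2 h3 h4 h5 h6; lra.
Qed.

Lemma forward_backward_contraction (C : R) : 0 < C -> 0 < mA + mB ->
  exists2 c, 0 < c < 1 & forall (M : H -> H) zb zh zs, linear M ->
    (forall x y, hdot (M x) y = hdot x (M y)) ->
    (forall x, 1 / beta * `|x| ^+ 2 <= hdot (M x) x) ->
    (forall x, hdot (M x) x <= C * `|x| ^+ 2) ->
    A zh (M (zb - zh) - B zb) -> A zs (- B zs) ->
    hdot (M (zh - zs)) (zh - zs) <= (1 - c) * hdot (M (zb - zs)) (zb - zs).
Proof.
move=> C0 mAB.
(* The moduli measured in the metric M. Young's inequality with weight 1 / beta uses one of the two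
   copies of <zb - zs, B zb - B zs>; the other copy supplies b. *)
pose a := mA / C; pose b := mB / C.
have a0 : 0 <= a by rewrite divr_ge0// ltW.
have b0 : 0 <= b by rewrite divr_ge0// ltW.
have ab0 : 0 < a + b by rewrite -mulrDl divr_gt0.
have den : 0 < 1 + 2 * (a + b) by lra.
(* One expression for both cases, with (1 - b) / (1 + 2 a) <= 1 - c. *)
exists ((a + b) / (1 + 2 * (a + b))).
  by rewrite divr_gt0//= ltr_pdivrMr//; lra.
move=> M zb zh zs lM sM coerM MC Azh Azs.
have := forward_backward_step lM sM Azh Azs.
have := coerM (zb - zh); have := B_coco zb zs.
have := cauchy_schwarz (zb - zh) (B zb - B zs).
have := B_mono zb zs; have := MC (zb - zs); have := MC (zh - zs).
have : 0 <= hdot (M (zb - zs)) (zb - zs).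
  by apply: le_trans (coerM _); rewrite mulr_ge0 ?divr_ge0 ?sqr_ge0// ltW.
set d := zb - zh; set D := B zb - B zs; set e := zh - zs; set z := zb - zs.
have : 0 <= beta^-1 * (`|d| - beta * `|D|) ^+ 2.
  by rewrite mulr_ge0 ?sqr_ge0 ?invr_ge0 ?(ltW beta0).
have -> : beta^-1 * (`|d| - beta * `|D|) ^+ 2
  = 1 / beta * `|d| ^+ 2 - 2 * (`|d| * `|D|) + beta * `|D| ^+ 2.
  by field; rewrite gt_eqF.
move=> h1 qz0 qe qz zD dD cD qd step.
have {}qe : a * hdot (M e) e <= mA * `|e| ^+ 2.
  rewrite /a -mulrA ler_wpM2l// ler_pdivrMl//.
have {}qz : b * hdot (M z) z <= mB * `|z| ^+ 2.
  rewrite /b -mulrA ler_wpM2l// ler_pdivrMl//.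
have h : (1 + 2 * a) * hdot (M e) e <= (1 - b) * hdot (M z) z by lra.
have a1 : 0 < 1 + 2 * a by lra.
rewrite -(ler_pM2l a1) (le_trans h)// mulrA ler_wpM2r//.
have -> : 1 - (a + b) / (1 + 2 * (a + b))
  = (1 + (a + b)) / (1 + 2 * (a + b)) by field; rewrite gt_eqF.
rewrite mulrA ler_pdivlMr//.
have : 0 <= a * b by exact: mulr_ge0.
have : 0 <= a * a by exact: mulr_ge0.
have : 0 <= b * b by exact: mulr_ge0.
lra.
Qed.

(* Cocoercivity upgrades the weak convergence of [zb] to [B zb --> B zs], so
   that only the strong-weak closedness of the maximal monotone [A] is used. *)
Lemma zero_of_weak_limit (I : Type) (F : set_system I) (zh zb a : I -> H)
    (C : R) l zs : ProperFilter F ->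
  (forall k, `|zh k| <= C) -> (forall k, `|zb k| <= C) ->
  wcvg F zh l -> wcvg F zb l -> (forall k, A (zh k) (a k)) ->
  a @ F --> - B zs -> (fun k => B (zb k)) @ F --> B zs -> A l (- B l).
Proof.
move=> FF zhC zbC zhl zbl Aa acvg Bcvg.
have shift (u : I -> H) w : (forall k, `|u k| <= C) ->
    forall k, `|u k - w| <= C + `|w|.
  by move=> uC k; rewrite (le_trans (ler_normB _ _))// lerD2r.
have wshift (u : I -> H) w : wcvg F u l -> wcvg F (fun k => u k - w) (l - w).
  by move=> ul; apply: wcvgD => //; apply: wcvg_strong; exact: cvg_cst.
(* Maximality needs only weak limits of zh paired with strong limits of a. *)
have Al : A l (- B zs).
  apply: A_max => z' a' Aa'.
  have h : hdot (zh k - z') (a k - a') @[k --> F]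
      --> hdot (l - z') (- B zs - a').
    apply: (wcvg_hdot (shift _ z' zhC) (wshift _ _ zhl)).
    by apply: cvgB => //; exact: cvg_cst.
  apply: (cvgr_to_ge h); apply: nearW => k.
  by apply: le_trans (A_mono (Aa k) Aa'); rewrite mulr_ge0 ?sqr_ge0.
suff <- : B zs = B l by [].
(* By cocoercivity |B zb - B l|^2 is dominated by an inner product tending to <l - l, B zs - B l> =
   0, so the limit of B zb is also B l. *)
have BD : (fun k => B (zb k) - B l) @ F --> B zs - B l.
  by apply: cvgB => //; exact: cvg_cst.
have h : hdot (zb k - l) (B (zb k) - B l) @[k --> F]
    --> hdot (l - l) (B zs - B l).
  exact: (wcvg_hdot (shift _ l zbC) (wshift _ _ zbl)).
rewrite subrr hdot0l in h.
have h' : B (zb k) - B l @[k --> F] --> (0 : H).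
  by apply: (cvg0_of_sqr_norm_le beta0 _ h) => k; exact: B_coco.
apply/eqP; rewrite -subr_eq0; apply/eqP.
by apply: (cvg_unique _ BD h').
Qed.

End monotone_inclusion.

Lemma inertial_linear_rate (R : realType) (a d alpha eta : nat -> R)
    (c ba Lambda : R) : 0 < c < 1 ->
  (forall k, 0 <= a k <= ba) -> (forall k, 0 <= d k) ->
  (forall k, 0 <= alpha k <= Lambda) -> summable_nneg eta ->
  (forall k, a k.+1 ^+ 2
     <= (1 + eta k) * ((1 - c) * (a k + alpha k * d k) ^+ 2)) ->
  exists (x Theta : R) (K0 : nat), [/\ 0 < x < 1, 0 < Theta
    & forall k, (K0 < k)%N ->
      a k ^+ 2 <= (1 - x) ^+ (k - K0) * a K0 ^+ 2
         + \sum_(K0 <= i < k) Theta * (1 - x) ^+ (k - i)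
             * alpha i * Num.max (d i) (d i ^+ 2)].
Proof.
move=> /andP[c0 c1] ab d0 alphaL etaS step.
have [eta0 _] := etaS.
have ba0 : 0 <= ba by have /andP[h h'] := ab 0%N; exact: le_trans h'.
have L0 : 0 <= Lambda by have /andP[h h'] := alphaL 0%N; exact: le_trans h'.
(* In the expanded square, 2 a alpha d and alpha^2 d^2 are at most 2 ba and Lambda times alpha
   max(d, d^2); the 1 makes Theta positive. *)
pose Theta := 2 * ba + Lambda + 1.
have c20 : 0 < c / 2 by rewrite divr_gt0.
(* Beyond [K0], eta k <= c / 2 and (1 + eta k) (1 - c) <= 1 - c / 2; half of the contraction is
   given up for the change of metric. *)
have [K0 _ etaK] := cvgr_le _ (summable_nneg_cvg0 etaS) _ c20.
exists (c / 2), Theta, K0; split; [lra|rewrite /Theta; lra|].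
have step' k : (K0 <= k)%N -> a k.+1 ^+ 2 <= (1 - c / 2)
    * (a k ^+ 2 + Theta * alpha k * Num.max (d k) (d k ^+ 2)).
  move=> Kk; apply: le_trans (step k) _; rewrite mulrA.
  apply: ler_pM.
  - by apply: mulr_ge0; [rewrite addr_ge0|rewrite subr_ge0 ltW].
  - exact: sqr_ge0.
  - have := etaK _ Kk; have := eta0 k => /= h1 h2.
    have := mulr_ge0 h1 (ltW c0); lra.
  have /andP[ak ak'] := ab k; have /andP[al al'] := alphaL k.
  set m := Num.max _ _.
  have m1 : d k <= m by rewrite le_max lexx.
  have m2 : d k ^+ 2 <= m by rewrite le_max lexx orbT.
  rewrite sqrrD -addrA lerD2l exprMn.
  have h1 : a k * (alpha k * d k) <= ba * (alpha k * m).
    by apply: ler_pM => //; rewrite ?mulr_ge0//; apply: ler_pM.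
  have h2 : alpha k ^+ 2 * d k ^+ 2 <= Lambda * (alpha k * m).
    rewrite expr2 -mulrA; apply: ler_pM => //; rewrite ?mulr_ge0 ?sqr_ge0//.
    by apply: ler_pM => //; exact: sqr_ge0.
  have h3 : 0 <= alpha k * m by rewrite mulr_ge0// (le_trans (d0 k)).
  rewrite /Theta; lra.
move=> k; elim: k => // k IH; rewrite ltnS leq_eqVlt => /predU1P[<-|Kk].
  rewrite big_nat1 subSnn !expr1; apply: le_trans (step' _ (leqnn _)) _.
  by rewrite le_eqVlt; apply/orP; left; apply/eqP; ring.
apply: le_trans (step' _ (ltnW Kk)) _.
rewrite big_nat_recr/=; last exact: ltnW.
have x0 : 0 <= 1 - c / 2 by lra.
rewrite mulrDr addrA; apply: lerD; last first.
  by rewrite subSnn expr1 !mulrA (mulrC _ Theta).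
apply: le_trans (ler_wpM2l x0 (IH Kk)) _.
rewrite mulrDr mulrA -exprS -subSn; last exact: ltnW.
rewrite lerD2l mulr_sumr le_eqVlt; apply/orP; left; apply/eqP.
apply: eq_big_nat => i /andP[_ ik].
by rewrite subSn ?(ltnW ik)// (exprS (1 - _)) !mulrA (mulrC _ Theta).
Qed.

(** * The inertial iteration in a variable metric *)

Section inertial_forward_backward.
Context {R : realType} {H : hilbertType R}.
Variables (A : H -> set H) (B : H -> H) (beta mA mB : R).
Hypotheses (beta0 : 0 < beta) (B_coco : cocoercive beta B).
Hypotheses (mA0 : 0 <= mA) (mB0 : 0 <= mB).
Hypothesis A_mono : forall z a z' a', A z a -> A z' a' ->
  mA * `|z - z'| ^+ 2 <= hdot (z - z') (a - a').
Hypothesis B_mono : forall z w, mB * `|z - w| ^+ 2 <= hdot (z - w) (B z - B w).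
Hypothesis A_max : forall z w,
  (forall z' a', A z' a' -> 0 <= hdot (z - z') (w - a')) -> A z w.
Variables (M : nat -> H -> H) (kappa C : R) (eta alpha e : nat -> R).
Hypotheses (linM : forall k, linear (M k)).
Hypothesis symM : forall k x y, hdot (M k x) y = hdot x (M k y).
Hypothesis kappa0 : 0 < kappa.
Hypothesis coerM : forall k x,
  (1 / (2 * beta) + kappa) * `|x| ^+ 2 <= hdot (M k x) x.
Hypotheses (C0 : 0 < C) (bndM : forall k x, `|M k x| <= C * `|x|).
Hypothesis etaS : summable_nneg eta.
Hypothesis decM : forall k x, hdot (M k.+1 x) x <= (1 + eta k) * hdot (M k x) x.
Variables z zp zh : nat -> H.
Hypothesis alpha0 : forall k, 0 <= alpha k.
Let dz k := normM (M k) (z k - zp k).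
Hypothesis dzS : summable_nneg (fun k => alpha k * dz k).
Let zb k := z k + alpha k *: (z k - zp k).
Hypothesis eS : summable_nneg e.
Hypothesis zhE : forall k, A (zh k) (M k (zb k - zh k) - B (zb k)).
Hypothesis zE : forall k, `|z k.+1 - zh k| <= e k.
Hypothesis ex_zero : exists zs, A zs (- B zs).

Let mu := 1 / (2 * beta) + kappa.
Let mu0 : 0 < mu. Proof. by rewrite addr_gt0// divr_gt0// mulr_gt0. Qed.
Let qM k x : normM (M k) x ^+ 2 = hdot (M k x) x.
Proof. exact: (sqr_normM mu0 (coerM k)). Qed.
Let qMC k x : hdot (M k x) x <= C * `|x| ^+ 2.
Proof.
rewrite (le_trans (cauchy_schwarz _ _))// expr2 mulrA.
by apply: ler_wpM2r.
Qed.
Let normM_le k x : normM (M k) x <= Num.sqrt C * `|x|.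
Proof.
rewrite -(ler_pXn2r (isT : (0 < 2)%N)) ?nnegrE ?mulr_ge0 ?sqrtr_ge0//.
by rewrite qM exprMn sqr_sqrtr ?(ltW C0).
Qed.
Let triM k x y : normM (M k) (x + y) <= normM (M k) x + normM (M k) y.
Proof. exact: (ler_normMD (linM k) (symM k) mu0 (coerM k)). Qed.

Section fixed_zero.
Variable zs : H.
Hypothesis zsE : A zs (- B zs).
Let a k := normM (M k) (z k - zs).
Let h k := normM (M k) (zh k - zs).
Let sC := Num.sqrt C.
Let a0 k : 0 <= a k := sqrtr_ge0 _.
Let h0 k : 0 <= h k := sqrtr_ge0 _.
Let eta0 : forall k, 0 <= eta k := let: conj p _ := etaS in p.

Lemma normM_extrapolated k : normM (M k) (zb k - zs) <= a k + alpha k * dz k.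
Proof.
have -> : zb k - zs = (z k - zs) + alpha k *: (z k - zp k).
  by rewrite /zb addrAC.
by rewrite (le_trans (triM _ _ _))// (normMZ (linM k)).
Qed.

Lemma normM_zh_le k : h k <= a k + alpha k * dz k.
Proof.
have [rho rho0 dec] := forward_backward_decrease beta0 B_coco mA0 A_mono kappa0.
apply: le_trans (normM_extrapolated k).
rewrite -(ler_pXn2r (isT : (0 < 2)%N)) ?nnegrE ?sqrtr_ge0//.
rewrite /h !qM.
have := dec _ _ _ _ (linM k) (symM k) (coerM k) (zhE k) zsE.
have : 0 <= kappa / 2 * `|zb k - zh k| ^+ 2.
  by rewrite mulr_ge0 ?sqr_ge0// divr_ge0// ltW.
have : 0 <= rho * `|B (zb k) - B zs| ^+ 2 by rewrite mulr_ge0 ?sqr_ge0// ltW.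
by lra.
Qed.

(** The square root of 1 + eta k is at most 1 + eta k, so the same summable sequence serves for
    norms. *)
Lemma normM_succ k x : normM (M k.+1) x <= (1 + eta k) * normM (M k) x.
Proof.
have e1 : 0 <= 1 + eta k by rewrite addr_ge0.
rewrite -(ler_pXn2r (isT : (0 < 2)%N)) ?nnegrE ?mulr_ge0 ?sqrtr_ge0//.
rewrite exprMn !qM (le_trans (decM k x))// ler_wpM2r -?qM ?sqr_ge0//.
by rewrite expr2 ler_peMr// lerDl.
Qed.

Lemma normM_step k : a k.+1 <= (1 + eta k) * (h k + sC * e k).
Proof.
rewrite /a (le_trans (normM_succ _ _))// ler_wpM2l ?addr_ge0//.
have -> : z k.+1 - zs = (zh k - zs) + (z k.+1 - zh k).
  by rewrite [RHS]addrC addrA subrK.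
rewrite (le_trans (triM _ _ _))// lerD2l (le_trans (normM_le _ _))//.
by rewrite ler_wpM2l ?sqrtr_ge0.
Qed.

Lemma inertial_fejer : cvgn a.
Proof.
apply: (quasi_fejer_cvg (delta := fun k => alpha k * dz k + sC * e k) a0 etaS).
  by apply: summable_nnegD => //; apply: summable_nnegZ; rewrite ?sqrtr_ge0.
move=> k; apply: (le_trans (normM_step k)).
by rewrite ler_wpM2l ?addr_ge0// addrA lerD2r normM_zh_le.
Qed.

(** [h k] is squeezed between a rescaled [a k.+1] and the extrapolated [a k], which have a common
    limit. The decrease of the squares therefore vanishes, and it dominates both residuals. *)
Lemma inertial_residuals : (zb k - zh k @[k --> \oo] --> (0 : H))
  /\ (fun k => B (zb k)) @ \oo --> B zs.
Proof.
have [rho rho0 dec] := forward_backward_decrease beta0 B_coco mA0 A_mono kappa0.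
have /cvg_ex[/= l al] := inertial_fejer.
have ub : (fun k => a k + alpha k * dz k) @ \oo --> l.
  rewrite -[X in _ --> X]addr0; apply: cvgD => //.
  exact: (summable_nneg_cvg0 dzS).
have lb : (fun k => (1 + eta k)^-1 * a k.+1 - sC * e k) @ \oo --> l.
  rewrite -[X in _ --> X]subr0; apply: cvgB; last first.
    by rewrite -(mulr0 sC); apply: cvgMr; exact: (summable_nneg_cvg0 eS).
  rewrite -[X in _ --> X]mul1r; apply: cvgM; last by rewrite -cvg_shiftS in al.
  rewrite -[X in _ --> X]invr1; apply: cvgV => //.
  rewrite -[X in _ --> X]addr0; apply: cvgD; first exact: cvg_cst.
  exact: (summable_nneg_cvg0 etaS).
have hl : h @ \oo --> l.
  apply: (squeeze_cvgr _ lb ub); apply: nearW => k.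
  rewrite normM_zh_le andbT lerBlDr ler_pdivrMl ?normM_step//.
  by rewrite ltr_pwDl.
have dec0 : (fun k => (a k + alpha k * dz k) ^+ 2 - h k ^+ 2) @ \oo --> 0.
  by rewrite -(subrr (l ^+ 2)); apply: cvgB; apply: cvgM.
have decE k : kappa / 2 * `|zb k - zh k| ^+ 2 + rho * `|B (zb k) - B zs| ^+ 2
    <= (a k + alpha k * dz k) ^+ 2 - h k ^+ 2.
  have := dec _ _ _ _ (linM k) (symM k) (coerM k) (zhE k) zsE.
  rewrite -!qM -/(h k).
  have := normM_extrapolated k.
  rewrite -(ler_pXn2r (isT : (0 < 2)%N)) ?nnegrE ?sqrtr_ge0 ?addr_ge0
    ?mulr_ge0 ?sqrtr_ge0//.
  by lra.
have d0 k : 0 <= kappa / 2 * `|zb k - zh k| ^+ 2.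
  by rewrite mulr_ge0 ?sqr_ge0// divr_ge0// ltW.
have D0 k : 0 <= rho * `|B (zb k) - B zs| ^+ 2.
  by rewrite mulr_ge0 ?sqr_ge0// ltW.
split.
  apply: (cvg0_of_sqr_norm_le (c := kappa / 2) _ _ dec0).
    by rewrite divr_gt0.
  by move=> k; have := decE k; have := D0 k; lra.
rewrite -[X in _ --> X]add0r.
have -> : (fun k => B (zb k)) = (fun k => (B (zb k) - B zs) + B zs).
  by apply/funext => k; rewrite subrK.
apply: cvgD; last exact: cvg_cst.
apply: (cvg0_of_sqr_norm_le rho0 _ dec0).
by move=> k; have := decE k; have := d0 k; lra.
Qed.

Lemma inertial_bounded : exists c, forall k, `|z k| <= c.
Proof.
have [c c0 ac] := cvgn_ubound inertial_fejer.
exists (c / Num.sqrt mu + `|zs|) => k.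
rewrite -[z k](subrK zs) (le_trans (ler_normD _ _))// lerD2r.
rewrite ler_pdivlMr ?sqrtr_gt0//.
apply: le_trans (ac k); rewrite -(ler_pXn2r (isT : (0 < 2)%N)) ?nnegrE//;
  rewrite ?mulr_ge0 ?sqrtr_ge0//.
by rewrite exprMn sqr_sqrtr ?(ltW mu0)// mulrC qM.
Qed.

End fixed_zero.

Lemma inertial_weak_cvg : exists2 zs, A zs (- B zs) & weakly_cvg z zs.
Proof.
have [zs0 zs0E] := ex_zero.
have [c zc] := inertial_bounded zs0E.
have [dh Bzb] := inertial_residuals zs0E.
have zbz : zb k - z k @[k --> \oo] --> (0 : H).
  apply: (cvg0_of_sqr_norm_le (c := mu)
    (u := fun k => (alpha k * dz k) ^+ 2)) => //.
    move=> k; have -> : zb k - z k = alpha k *: (z k - zp k).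
      by rewrite /zb addrAC subrr add0r.
    by rewrite -(normMZ (linM k))// qM.
  have := summable_nneg_cvg0 dzS => h.
  by rewrite -(mulr0 0); apply: cvgM.
have zhz : zh k - z k @[k --> \oo] --> (0 : H).
  have -> : (fun k => zh k - z k) = (fun k => (zb k - z k) - (zb k - zh k)).
    by apply/funext => k; rewrite opprB [RHS]addrC addrA subrK.
  by rewrite -[X in _ --> X]subr0; apply: cvgB.
have bounded_near (u : nat -> H) : u k - z k @[k --> \oo] --> (0 : H) ->
    exists cu, forall k, `|u k| <= cu.
  move=> uz; have un : cvgn (fun k => `|u k - z k|).
    by apply/cvg_ex; exists `|0 : H|; apply: cvg_norm.
  have [cu _ hu] := cvgn_ubound un; exists (cu + c) => k.
  by rewrite -[u k](subrK (z k)) (le_trans (ler_normD _ _))// lerD.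
have [c1 zbc] := bounded_near _ zbz.
have [c2 zhc] := bounded_near _ zhz.
apply: (opial zc).
  move=> F FU oF l zl.
  have wl (u : nat -> H) : u k - z k @[k --> \oo] --> (0 : H) -> wcvg F u l.
    move=> uz; have -> : u = (fun k => z k + (u k - z k)).
      by apply/funext => k; rewrite addrC subrK.
    rewrite -[l]addr0; apply: wcvgD => //; apply: wcvg_strong.
    by apply: cvg_trans uz; exact: cvg_app.
  apply: (zero_of_weak_limit beta0 B_coco mA0 A_mono A_max (F := F)
    (zh := zh) (zb := zb) (a := fun k => M k (zb k - zh k) - B (zb k))
    (C := Num.max c1 c2) (zs := zs0)) => //.
  - by move=> k; rewrite le_max zhc orbT.
  - by move=> k; rewrite le_max zbc.
  - exact: wl.
  - exact: wl.
  - suff h : (fun k => M k (zb k - zh k) - B (zb k)) @ \oo --> - B zs0.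
      by apply: cvg_trans h; exact: cvg_app.
    rewrite -[X in _ --> X]sub0r; apply: cvgB => //.
    apply: (cvg0_of_norm_le (u := fun k => C * `|zb k - zh k|)) => //.
    rewrite -(mulr0 C); apply: cvgMr; rewrite -(@normr0 _ H).
    exact: cvg_norm.
  - by apply: cvg_trans Bzb; exact: cvg_app.
move=> z1 z2 z1E z2E.
have Mcvg d : cvgn (fun k => M k d).
  apply: (quasi_decreasing_cvg linM symM C0 _ etaS decM) => k x.
  by rewrite qMC -qM sqr_ge0.
have /cvg_ex[/= d Md] := Mcvg (z1 - z2).
have /cvg_ex[/= d1 Md1] := Mcvg z1.
have /cvg_ex[/= d2 Md2] := Mcvg z2.
have /cvg_ex[/= l1 al1] := inertial_fejer z1E.
have /cvg_ex[/= l2 al2] := inertial_fejer z2E.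
(* Polarization: the squared M_k-distances from z_k to z1 and z2 differ by - 2 <z_k, M_k (z1 - z2)>
   plus terms free of z_k. The distances converge by the Fejer property, the rest by strong
   convergence of M_k; coercivity passes to d and separates z1 from z2. *)
exists (fun k => M k (z1 - z2)), d,
  (2^-1 * ((hdot d1 z1 - hdot d2 z2) - (l1 ^+ 2 - l2 ^+ 2))).
split=> //.
  have -> : (fun k => hdot (z k) (M k (z1 - z2))) = (fun k => 2^-1 *
    ((hdot (M k z1) z1 - hdot (M k z2) z2)
     - (normM (M k) (z k - z1) ^+ 2 - normM (M k) (z k - z2) ^+ 2))).
    apply/funext => k; rewrite !qM !(linear_predB (linM k)) !hdotE.
    rewrite (symM k z1 (z k)) (symM k z2 (z k)) (hdotC z1 (M k (z k))).
    rewrite (hdotC z2 (M k (z k))) !(symM k (z k)).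
    by lra.
  apply: cvgMr; apply: cvgB; apply: cvgB; try exact: wcvg_strong.
  - by apply: cvgM.
  - by apply: cvgM.
move=> z0; apply/eqP; rewrite -subr_eq0 -normr_eq0 -sqrf_eq0.
have h : hdot (M k (z1 - z2)) (z1 - z2) @[k --> \oo] --> hdot d (z1 - z2).
  exact: wcvg_strong.
have : mu * `|z1 - z2| ^+ 2 <= hdot d (z1 - z2).
  by apply: (cvgr_to_ge h); apply: nearW => k; exact: coerM.
by rewrite hdotC z0 pmulr_rle0// => h1; rewrite eq_le h1 sqr_ge0.
Qed.

(** The contraction holds in the metric M_k, and passing to M_{k+1} costs 1 + eta k. The bound
    needed for [Theta] comes from [inertial_fejer]. *)
Lemma inertial_linear_cvg (Lambda : R) zs : A zs (- B zs) ->
  0 < mA + mB -> (forall k, z k.+1 = zh k) ->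
  (forall k x, 1 / beta * `|x| ^+ 2 <= hdot (M k x) x) ->
  (forall k, alpha k <= Lambda) ->
  exists (x Theta : R) (K0 : nat), [/\ 0 < x < 1, 0 < Theta
    & forall k, (K0 < k)%N ->
      normM (M k) (z k - zs) ^+ 2
      <= (1 - x) ^+ (k - K0) * normM (M K0) (z K0 - zs) ^+ 2
         + \sum_(K0 <= i < k) Theta * (1 - x) ^+ (k - i)
             * alpha i * Num.max (dz i) (dz i ^+ 2)].
Proof.
move=> zsE mAB zzh coerM' alphaL.
have [c c01 contr] := forward_backward_contraction beta0 B_coco mA0 mB0
  A_mono B_mono C0 mAB.
have [ba _ aba] := cvgn_ubound (inertial_fejer zsE).
apply: (inertial_linear_rate (a := fun k => normM (M k) (z k - zs)) (d := dz)
  (c := c) (ba := ba) (Lambda := Lambda) (eta := eta)) => //.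
- by move=> k; rewrite sqrtr_ge0/=.
- by move=> k; exact: sqrtr_ge0.
- by move=> k; rewrite alpha0 alphaL.
move=> k; have [eta0 _] := etaS; have /andP[c0 c1] := c01.
rewrite qM (le_trans (decM _ _))// ler_wpM2l ?addr_ge0// zzh.
have := contr _ _ _ _ (linM k) (symM k) (coerM' k) (qMC k) (zhE k) zsE.
move=> /le_trans; apply; rewrite ler_wpM2l ?subr_ge0 ?(ltW c1)//.
rewrite -qM ler_pXn2r ?nnegrE ?sqrtr_ge0 ?addr_ge0 ?mulr_ge0 ?sqrtr_ge0//.
exact: normM_extrapolated.
Qed.

End inertial_forward_backward.

(** * The relaxed iteration *)

Section relaxed_forward_backward.
Context {R : realType} {H : hilbertType R}.
Variables (A : H -> set H) (B : H -> H) (beta mA mB : R).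
Hypotheses (beta0 : 0 < beta) (B_coco : cocoercive beta B).
Hypotheses (mA0 : 0 <= mA) (mB0 : 0 <= mB).
Hypothesis A_mono : forall z a z' a', A z a -> A z' a' ->
  mA * `|z - z'| ^+ 2 <= hdot (z - z') (a - a').
Hypothesis B_mono : forall z w, mB * `|z - w| ^+ 2 <= hdot (z - w) (B z - B w).
Hypothesis A_max : forall z w,
  (forall z' a', A z' a' -> 0 <= hdot (z - z') (w - a')) -> A z w.
Variables (M : nat -> H -> H) (c C : R) (e : nat -> R).
Hypotheses (linM : forall k, linear (M k)).
Hypothesis symM : forall k x y, hdot (M k x) y = hdot x (M k y).
Hypothesis c0 : 0 < c.
Hypothesis coerM : forall k x, (1 / beta + c) * `|x| ^+ 2 <= hdot (M k x) x.
Hypotheses (C0 : 0 < C) (bndM : forall k x, `|M k x| <= C * `|x|).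
Variables z zt zh : nat -> H.
Let v k := M k (z k - zt k) + B (zt k) - B (z k).
Let t k := hdot (z k - zt k) (v k) / (2 * `|v k| ^+ 2).
Hypothesis zS : forall k, z k.+1 = z k - t k *: v k.
Hypothesis zhE : forall k, A (zh k) (M k (z k - zh k) - B (z k)).
Hypothesis eS : summable_nneg e.
Hypothesis zth : forall k, `|zt k - zh k| <= e k.
Hypothesis ztz : forall k, zt k != z k.

Let p k := `|z k - zt k|.
(** A Lipschitz constant of M_k - B, uniform in k. *)
Let C2 := C + beta^-1.
Let C20 : 0 < C2. Proof. by rewrite addr_gt0 ?invr_gt0. Qed.
Let p0 k : 0 < p k.
Proof. by rewrite normr_gt0 subr_eq0 eq_sym. Qed.

Let residual_le k x y : `|M k (x - y) + B y - B x| <= C2 * `|x - y|.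
Proof.
rewrite -addrA (le_trans (ler_normD _ _))// mulrDl lerD//.
by rewrite distrC; exact: cocoercive_lipschitz.
Qed.

(** The part 1 / beta of the coercivity of M_k pays for the Lipschitz constant of B, leaving c. *)
Lemma relaxed_dot_ge k : c * p k ^+ 2 <= hdot (z k - zt k) (v k).
Proof.
have -> : v k = M k (z k - zt k) - (B (z k) - B (zt k)).
  by rewrite /v opprB addrA.
rewrite [X in _ <= X]hdotBr [hdot _ (M k _)]hdotC.
have := coerM k (z k - zt k).
have := cauchy_schwarz (z k - zt k) (B (z k) - B (zt k)).
have := ler_wpM2l (ltW (p0 k)) (cocoercive_lipschitz beta0 B_coco (z k) (zt k)).
rewrite -/(p k) div1r mulrCA -expr2; lra.
Qed.

Lemma relaxed_v_ge k : c * p k <= `|v k|.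
Proof.
rewrite -(ler_pM2l (p0 k)) mulrCA -expr2 (le_trans (relaxed_dot_ge k))//.
exact: cauchy_schwarz.
Qed.

Let v0 k : 0 < `|v k|.
Proof. by rewrite (lt_le_trans _ (relaxed_v_ge k))// mulr_gt0. Qed.

Lemma relaxed_tE k : hdot (z k - zt k) (v k) = 2 * (t k * `|v k| ^+ 2).
Proof.
by rewrite /t invfM; field; rewrite gt_eqF.
Qed.

Lemma relaxed_t_ge k : c / (2 * C2 ^+ 2) <= t k.
Proof.
have c22 : 0 < 2 * C2 ^+ 2 by rewrite mulr_gt0// exprn_gt0.
have v2 : 0 < 2 * `|v k| ^+ 2 by rewrite mulr_gt0// exprn_gt0.
rewrite /t ler_pdivlMr// mulrAC ler_pdivrMr//.
apply: (@le_trans _ _ (c * (2 * (C2 * p k) ^+ 2))).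
  rewrite ler_pM2l// ler_pM2l// ler_pXn2r ?nnegrE ?mulr_ge0
    ?(ltW C20) ?(ltW (p0 k))//.
  exact: residual_le.
rewrite exprMn.
have := ler_wpM2r (ltW c22) (relaxed_dot_ge k); lra.
Qed.

Lemma relaxed_t_gt0 k : 0 < t k.
Proof.
rewrite (lt_le_trans _ (relaxed_t_ge k))// divr_gt0// mulr_gt0//.
by rewrite exprn_gt0.
Qed.

Lemma relaxed_t_le k : 2 * t k <= c^-1.
Proof.
have v2 : 0 < `|v k| ^+ 2 by rewrite exprn_gt0.
rewrite -(ler_pM2l c0) mulfV ?gt_eqF// -(ler_pM2r v2) mul1r.
have := cauchy_schwarz (z k - zt k) (v k); rewrite relaxed_tE => h.
apply: (@le_trans _ _ (c * (p k * `|v k|))).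
  rewrite -(mulrA c) -(mulrA 2) ler_pM2l//; exact: h.
rewrite mulrA expr2 ler_pM2r//; exact: relaxed_v_ge.
Qed.

Lemma relaxed_tv_le k : 2 * (t k * `|v k|) <= p k.
Proof.
rewrite -(ler_pM2r (v0 k)) -(mulrA 2) -(mulrA (t k)) -expr2 -relaxed_tE.
exact: cauchy_schwarz.
Qed.

(** Makes the step length t_k |v_k| control the residual |z_k - zt_k|, which is how the gain in
    [relaxed_step] becomes useful. *)
Lemma relaxed_tv_ge k : c / (2 * C2) * p k <= t k * `|v k|.
Proof.
have c22 : 0 < 2 * C2 by rewrite mulr_gt0.
rewrite mulrAC ler_pdivrMr// -(ler_pM2r (p0 k)) -mulrA -expr2.
apply: le_trans (relaxed_dot_ge k) _; rewrite relaxed_tE expr2.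
have := residual_le k (z k) (zt k); rewrite -/(v k) -/(p k) => h.
have tv0 : 0 <= t k * `|v k| by rewrite mulr_ge0// ltW// relaxed_t_gt0.
have := ler_wpM2l tv0 h; lra.
Qed.

Section fixed_zero.
Variable zs : H.
Hypothesis zsE : A zs (- B zs).
Let n k := `|z k - zs|.
Let E k := `|zt k - zh k|.
Let C3 := Num.sqrt (C / (1 / beta + c)).
Let mu0 : 0 < 1 / beta + c. Proof. by rewrite addr_gt0// divr_gt0. Qed.

Lemma relaxed_zh_le k : `|zh k - zs| <= C3 * n k.
Proof.
(* Since 1 / beta is twice 1 / (2 beta), [forward_backward_decrease] applies with this value as
   kappa. [C3] then compares the metric M_k with the norm of H. *)
have k0 : 0 < 1 / (2 * beta) + c by rewrite addr_gt0// divr_gt0// mulr_gt0.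
have [rho rho0 dec] := forward_backward_decrease beta0 B_coco mA0 A_mono k0.
have coer' x : (1 / (2 * beta) + (1 / (2 * beta) + c)) * `|x| ^+ 2
    <= hdot (M k x) x.
  rewrite (_ : 1 / (2 * beta) + (1 / (2 * beta) + c) = 1 / beta + c)//.
  by field; rewrite gt_eqF.
have := dec _ _ _ _ (linM k) (symM k) coer' (zhE k) zsE => h.
rewrite -(ler_pXn2r (isT : (0 < 2)%N)) ?nnegrE ?mulr_ge0 ?sqrtr_ge0
  ?normr_ge0//.
rewrite exprMn sqr_sqrtr ?divr_ge0 ?(ltW C0) ?(ltW mu0)// mulrAC ler_pdivlMr//.
rewrite mulrC (le_trans (coerM k _))//.
have h1 : hdot (M k (z k - zs)) (z k - zs) <= C * n k ^+ 2.
  rewrite (le_trans (cauchy_schwarz _ _))// expr2 mulrA.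
  by apply: ler_wpM2r.
have h2 : 0 <= (1 / (2 * beta) + c) / 2 * `|z k - zh k| ^+ 2.
  by rewrite mulr_ge0 ?sqr_ge0// divr_ge0// ltW.
have h3 : 0 <= rho * `|B (z k) - B zs| ^+ 2.
  by rewrite mulr_ge0 ?sqr_ge0// ltW.
lra.
Qed.

(** The vector on the right lies in (A + B) zh_k, and 0 lies in (A + B) zs; the moduli of A and B
    add up. *)
Lemma residual_dot_ge k : (mA + mB) * `|zh k - zs| ^+ 2
  <= hdot (zh k - zs) (M k (z k - zh k) + B (zh k) - B (z k)).
Proof.
have := A_mono (zhE k) zsE; have := B_mono (zh k) zs.
have -> : M k (z k - zh k) + B (zh k) - B (z k)
    = (M k (z k - zh k) - B (z k) - - B zs) + (B (zh k) - B zs).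
  by rewrite opprK -[RHS]addrA [B zs + _]addrC subrK addrAC.
rewrite [X in _ -> _ -> _ <= X]hdotDr; lra.
Qed.

(** By [relaxed_tE], the part z_k - zt_k of z_k - zs contributes - 4 (t |v|)^2 to the expanded
    square, and + (t |v|)^2 comes from the step itself: hence the 3. The errors come from zt_k -
    zh_k and from replacing v_k by the residual [vh] of the exact step. *)
Lemma relaxed_step k : n k.+1 ^+ 2 + 3 * (t k * `|v k|) ^+ 2
    + 2 * t k * (mA + mB) * `|zh k - zs| ^+ 2
  <= n k ^+ 2 + 2 * t k * (C2 * E k * `|zh k - zs| + E k * `|v k|).
Proof.
pose vh := M k (z k - zh k) + B (zh k) - B (z k).
have vvh : `|v k - vh| <= C2 * E k.
  have -> : v k - vh = M k (zh k - zt k) + B (zt k) - B (zh k).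
    have -> : zh k - zt k = (z k - zt k) - (z k - zh k).
      by rewrite opprB [RHS]addrC addrA subrK.
    rewrite (linear_predB (linM k)) /v /vh opprB addrA subrK.
    by rewrite opprD addrACA addrA.
  by rewrite (le_trans (residual_le _ _ _))// distrC.
have zzs : z k - zs = (z k - zt k) + (zt k - zh k) + (zh k - zs).
  by rewrite !addrA !subrK.
have nS : n k.+1 ^+ 2 = n k ^+ 2 - 2 * (t k * hdot (z k - zs) (v k))
    + (t k * `|v k|) ^+ 2.
  rewrite /n zS addrAC (sqr_normB (z k - zs)) hdotZr normrZ.
  by rewrite (gtr0_norm (relaxed_t_gt0 k)).
have dotE : hdot (z k - zs) (v k) = 2 * (t k * `|v k| ^+ 2)
    + hdot (zt k - zh k) (v k) + hdot (zh k - zs) (v k - vh)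
    + hdot (zh k - zs) vh.
  by rewrite zzs 2!hdotDl relaxed_tE -[RHS]addrA -hdotDr subrK.
have h1 : - (E k * `|v k|) <= hdot (zt k - zh k) (v k).
  have := cauchy_schwarz_abs (zt k - zh k) (v k).
  by rewrite ler_norml => /andP[].
have h2 : - (C2 * E k * `|zh k - zs|) <= hdot (zh k - zs) (v k - vh).
  have := cauchy_schwarz_abs (zh k - zs) (v k - vh).
  rewrite ler_norml => /andP[h _]; apply: le_trans h; rewrite lerN2 mulrC.
  by rewrite ler_wpM2r.
have h3 := residual_dot_ge k; rewrite -/vh in h3.
have h : 2 * (t k * `|v k| ^+ 2) + (mA + mB) * `|zh k - zs| ^+ 2
    - (C2 * E k * `|zh k - zs| + E k * `|v k|) <= hdot (z k - zs) (v k).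
  by rewrite dotE; lra.
have t20 : 0 <= 2 * t k by rewrite mulr_ge0// ltW// relaxed_t_gt0.
have := ler_wpM2l t20 h; rewrite nS exprMn.
move: (hdot _ _) (`|v k|) (C2 * E k * _) => X V Y; move: (E k * V) => W.
lra.
Qed.

(** Collects the coefficients of n k * E k among the errors of [relaxed_step]; as C4 >= 1, the
    remaining E k ^+ 2 also fits into the square of n k + C4 * E k. *)
Let C4 := C2 * C3 / c + 1 + C3.

Lemma relaxed_quasi_fejer k :
  n k.+1 ^+ 2 + 3 * (t k * `|v k|) ^+ 2 <= (n k + C4 * E k) ^+ 2.
Proof.
have h := relaxed_step k.
have E0 : 0 <= E k by exact: normr_ge0.
have n0 : 0 <= n k by exact: normr_ge0.
have C30 : 0 <= C3 by exact: sqrtr_ge0.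
have t0 := relaxed_t_gt0 k.
have c10 : 0 <= c^-1 by rewrite invr_ge0 ltW.
have h1 : 2 * t k * (C2 * E k * `|zh k - zs|) <= c^-1 * (C2 * E k * (C3 * n k)).
  apply: ler_pM; first by rewrite mulr_ge0// ltW.
  - by rewrite !mulr_ge0// ltW.
  - exact: relaxed_t_le.
  - by apply: ler_wpM2l; [rewrite mulr_ge0// ltW|exact: relaxed_zh_le].
have h2 : 2 * (t k * `|v k|) * E k <= (n k + C3 * n k + E k) * E k.
  rewrite ler_wpM2r// (le_trans (relaxed_tv_le k))// /p.
  have -> : z k - zt k = (z k - zs) - (zh k - zs) - (zt k - zh k).
    by rewrite !opprB !addrA !subrK.
  rewrite (le_trans (ler_normB _ _))// lerD2r (le_trans (ler_normB _ _))//.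
  by rewrite lerD2l relaxed_zh_le.
have h3 : 0 <= 2 * t k * (mA + mB) * `|zh k - zs| ^+ 2.
  by rewrite mulr_ge0 ?sqr_ge0// mulr_ge0 ?addr_ge0// mulr_ge0// ltW.
have h4 : 1 <= C4.
  have : 0 <= C2 * C3 / c by rewrite mulr_ge0// mulr_ge0// ltW.
  by rewrite /C4; lra.
have h5 : 0 <= (C4 ^+ 2 - 1) * E k ^+ 2.
  by rewrite mulr_ge0 ?sqr_ge0// subr_ge0 exprn_ege1.
have h6 : 0 <= C4 * (n k * E k).
  by apply: mulr_ge0; [exact: le_trans h4|exact: mulr_ge0].
have e1 : c^-1 * (C2 * E k * (C3 * n k)) + (n k + C3 * n k + E k) * E k
  = C4 * (n k * E k) + E k ^+ 2 by rewrite /C4; ring.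
rewrite sqrrD exprMn.
move: h h1 h2 h3 h5 h6 e1; rewrite mulrDr.
move: (n k.+1 ^+ 2) => ?; lra.
Qed.

Lemma relaxed_fejer : cvgn n.
Proof.
have C40 : 0 <= C4.
  by rewrite !addr_ge0 ?mulr_ge0 ?invr_ge0 ?sqrtr_ge0// ltW.
apply: (quasi_fejer_cvg (eta := fun=> 0) (delta := fun k => C4 * E k)).
- by move=> k; exact: normr_ge0.
- exact: summable_nneg0.
- apply: summable_nnegZ => //; apply: (summable_nneg_le (b := e)) => [k|].
    by rewrite normr_ge0 zth.
  by have [] := eS.
move=> k; rewrite addr0 mul1r.
rewrite -(ler_pXn2r (isT : (0 < 2)%N)) ?nnegrE ?addr_ge0 ?mulr_ge0 ?normr_ge0//.
by apply: le_trans (relaxed_quasi_fejer k); rewrite lerDl mulr_ge0 ?sqr_ge0.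
Qed.

Lemma relaxed_residuals : (z k - zt k @[k --> \oo] --> (0 : H))
  /\ (zt k - zh k @[k --> \oo] --> (0 : H)).
Proof.
have E0 : E @ \oo --> 0.
  apply: (cvg0_of_le (w := e)) => [k|]; first by rewrite normr_ge0 zth.
  exact: summable_nneg_cvg0.
split; last exact: (cvg0_of_norm_le _ E0).
have /cvg_ex[/= l nl] := relaxed_fejer.
have h : (fun k => (n k + C4 * E k) ^+ 2 - n k.+1 ^+ 2) @ \oo --> 0.
  have nS : (fun k => n k.+1) @ \oo --> l by rewrite -cvg_shiftS in nl.
  have nE : (fun k => n k + C4 * E k) @ \oo --> l.
    rewrite -[X in _ --> X]addr0; apply: cvgD => //.
    by rewrite -(mulr0 C4); apply: cvgMr.
  by rewrite -(subrr (l ^+ 2)); apply: cvgB; apply: cvgM.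
have c2 : 0 < 3 * (c / (2 * C2)) ^+ 2.
  by rewrite mulr_gt0// exprn_gt0// divr_gt0// mulr_gt0.
apply: (cvg0_of_sqr_norm_le c2 _ h) => k.
rewrite lerBrDl (le_trans _ (relaxed_quasi_fejer k))// lerD2l -/(p k).
rewrite -mulrA -exprMn ler_pM2l// ler_pXn2r ?nnegrE ?relaxed_tv_ge//.
  by rewrite mulr_ge0 ?divr_ge0 ?mulr_ge0 ?(ltW c0) ?(ltW C20) ?(ltW (p0 k)).
by rewrite mulr_ge0// ltW// relaxed_t_gt0.
Qed.

Lemma relaxed_bounded : exists b, forall k, `|z k| <= b.
Proof.
have [b _ nb] := cvgn_ubound relaxed_fejer; exists (b + `|zs|) => k.
by rewrite -[z k](subrK zs) (le_trans (ler_normD _ _))// lerD2r nb.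
Qed.

End fixed_zero.

Lemma relaxed_weak_cvg : (exists zs, A zs (- B zs)) ->
  exists2 zs, A zs (- B zs) & weakly_cvg z zs.
Proof.
move=> [zs zsE]; have [b zb] := relaxed_bounded zsE.
have [zzt ztzh] := relaxed_residuals zsE.
have zzh : zh k - z k @[k --> \oo] --> (0 : H).
  have -> : (fun k => zh k - z k)
      = (fun k => - ((z k - zt k) + (zt k - zh k))).
    by apply/funext => k; rewrite addrA subrK opprB.
  by rewrite -oppr0 -[X in - X](addr0 0); apply: cvgN; apply: cvgD.
have nzh : `|z k - zh k| @[k --> \oo] --> 0.
  under eq_fun do rewrite distrC.
  by rewrite -(@normr0 _ H); exact: cvg_norm.
have [b' zhb] : exists b', forall k, `|zh k| <= b'.
  have [b' _ h] := cvgn_ubound (cvgP _ nzh); exists (b' + b) => k.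
  rewrite -[zh k](subrK (z k)) (le_trans (ler_normD _ _))// lerD//.
  by rewrite distrC.
pose vh k := M k (z k - zh k) + B (zh k) - B (z k).
(* <zh_k - zs, vh k> dominates beta |B zh_k - B zs|^2, and the residual tends to 0 against a bounded
   factor; this gives the strong convergence of B zh_k. *)
have nvh : (fun k => (b' + `|zs|) * `|vh k|) @ \oo --> 0.
  apply: (cvg0_of_le (w := fun k => (b' + `|zs|) * (C2 * `|z k - zh k|))).
    move=> k; have b's : 0 <= b' + `|zs|.
      by rewrite addr_ge0// (le_trans _ (zhb 0%N)).
    by rewrite mulr_ge0//= ler_wpM2l//; exact: residual_le.
  by rewrite -(mulr0 (b' + `|zs|)) -[X in _ * X](mulr0 C2);
    apply: cvgMr; apply: cvgMr.
have vh0 : vh @ \oo --> (0 : H).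
  apply: (cvg0_of_norm_le (u := fun k => C2 * `|z k - zh k|)).
    by move=> k; exact: residual_le.
  by rewrite -(mulr0 C2); apply: cvgMr.
have Bzh : (fun k => B (zh k)) @ \oo --> B zs.
  have -> : (fun k => B (zh k)) = (fun k => (B (zh k) - B zs) + B zs).
    by apply/funext => k; rewrite subrK.
  rewrite -[X in _ --> X]add0r; apply: cvgD; last exact: cvg_cst.
  apply: (cvg0_of_sqr_norm_le beta0 _ nvh) => k.
  apply: (@le_trans _ _ (hdot (zh k - zs) (vh k))).
    have := A_mono (zhE k) zsE; have := B_coco (zh k) zs.
    have -> : vh k = (M k (z k - zh k) - B (z k) - - B zs) + (B (zh k) - B zs).
      by rewrite opprK -[RHS]addrA [B zs + _]addrC subrK addrAC.
    have : 0 <= mA * `|zh k - zs| ^+ 2 by rewrite mulr_ge0 ?sqr_ge0.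
    rewrite [X in _ -> _ -> _ -> _ <= X]hdotDr; lra.
  rewrite (le_trans (cauchy_schwarz _ _))// ler_wpM2r//.
  by rewrite (le_trans (ler_normB _ _))// lerD2r.
apply: (opial zb).
  move=> F FU oF l zl.
  have zhl : wcvg F zh l.
    have -> : zh = (fun k => z k + (zh k - z k)).
      by apply/funext => k; rewrite addrC subrK.
    rewrite -[l]addr0; apply: wcvgD => //; apply: wcvg_strong.
    by apply: cvg_trans zzh; exact: cvg_app.
  apply: (zero_of_weak_limit beta0 B_coco mA0 A_mono A_max (F := F)
    (zh := zh) (zb := zh) (a := fun k => M k (z k - zh k) - B (z k))
    (C := b') (zs := zs)) => //.
  - suff h : (fun k => M k (z k - zh k) - B (z k)) @ \oo --> - B zs.
      by apply: cvg_trans h; exact: cvg_app.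
    have -> : (fun k => M k (z k - zh k) - B (z k))
        = (fun k => vh k - B (zh k)).
      by apply/funext => k; rewrite /vh addrAC addrK.
    by rewrite -[X in _ --> X]sub0r; apply: cvgB.
  - by apply: cvg_trans Bzh; exact: cvg_app.
move=> z1 z2 z1E z2E.
have /cvg_ex[/= l1 al1] := relaxed_fejer z1E.
have /cvg_ex[/= l2 al2] := relaxed_fejer z2E.
exists (fun=> z1 - z2), (z1 - z2),
  (2^-1 * ((`|z1| ^+ 2 - `|z2| ^+ 2) - (l1 ^+ 2 - l2 ^+ 2))).
split=> //; first exact: cvg_cst.
- have -> : (fun k => hdot (z k) (z1 - z2)) = (fun k => 2^-1 *
    ((`|z1| ^+ 2 - `|z2| ^+ 2) - (`|z k - z1| ^+ 2 - `|z k - z2| ^+ 2))).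
    by apply/funext => k; rewrite !sqr_normB hdotBr; lra.
  apply: cvgMr; apply: cvgB; first exact: cvg_cst.
  by apply: cvgB; apply: cvgM.
move=> h; apply/eqP; rewrite -subr_eq0 -normr_eq0 -sqrf_eq0 -hdotxx.
by rewrite h.
Qed.

Lemma relaxed_linear_cvg : 0 < mA + mB -> (forall k, zt k = zh k) ->
  exists2 x : R, 0 < x < 1 & forall zs, A zs (- B zs) ->
    forall k, `|z k - zs| ^+ 2 <= (1 - x) ^+ k * `|z 0%N - zs| ^+ 2.
Proof.
move=> mAB ztE.
(* Without errors [relaxed_step] gains at least d1 |z - zt|^2 + d2 |zh - zs|^2, and |z - zs|^2 is at
   most twice the sum of these squares, whence the rate d / 2. It is fixed before [zs] and so serves
   all solutions. *)
pose d1 := 3 * (c / (2 * C2)) ^+ 2.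
pose d2 := c / C2 ^+ 2 * (mA + mB).
have d10 : 0 < d1 by rewrite mulr_gt0// exprn_gt0// divr_gt0// mulr_gt0.
have d20 : 0 < d2 by rewrite mulr_gt0// divr_gt0// exprn_gt0.
pose d := Num.min d1 (Num.min d2 1).
have d0 : 0 < d by rewrite !lt_min d10 d20 ltr01.
have dd1 : d <= d1 by rewrite ge_min lexx.
have dd2 : d <= d2 by rewrite !ge_min lexx !orbT.
have d_1 : d <= 1 by rewrite !ge_min lexx !orbT.
exists (d / 2); first by rewrite divr_gt0//=; lra.
move=> zs zsE; elim=> [|k IH]; first by rewrite expr0 mul1r.
have x0 : 0 <= 1 - d / 2 by lra.
rewrite (exprS (1 - _)) -mulrA (le_trans _ (ler_wpM2l x0 IH))//.
have := relaxed_step zsE k; rewrite ztE subrr normr0 mulr0 !mul0r addr0.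
rewrite mulr0 addr0.
have h1 : d * p k ^+ 2 <= 3 * (t k * `|v k|) ^+ 2.
  apply: (@le_trans _ _ (d1 * p k ^+ 2)); first by rewrite ler_wpM2r ?sqr_ge0.
  rewrite /d1 -mulrA -exprMn ler_pM2l// ler_pXn2r ?nnegrE ?relaxed_tv_ge//.
    by rewrite mulr_ge0 ?divr_ge0 ?mulr_ge0 ?(ltW c0) ?(ltW C20) ?(ltW (p0 k)).
  by rewrite mulr_ge0// ltW// relaxed_t_gt0.
have h2 : d * `|zh k - zs| ^+ 2
    <= 2 * t k * (mA + mB) * `|zh k - zs| ^+ 2.
  rewrite ler_wpM2r ?sqr_ge0// (le_trans dd2)// /d2 ler_wpM2r ?(ltW mAB)//.
  have := relaxed_t_ge k; rewrite invfM mulrCA mulrC; lra.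
have h3 : `|z k - zs| ^+ 2 <= 2 * (p k ^+ 2 + `|zh k - zs| ^+ 2).
  rewrite (_ : z k - zs = (z k - zt k) + (zh k - zs)).
    exact: sqr_norm_le_twice.
  by rewrite ztE addrA subrK.
have h4 := ler_wpM2l (ltW d0) h3.
move: h1 h2 h4.
by move: (3 * _ ^+ 2) (2 * t k * (mA + mB) * _) => X Y; lra.
Qed.

End relaxed_forward_backward.

(** * The saddle point problem *)

Lemma opnorm_bound (R : realType) (H : hilbertType R) (M : H -> H) :
  bounded_selfadjoint M -> forall x, `|M x| <= opnorm M * `|x|.
Proof.
move=> [lM cM _] x; have [L L0 ML] := linear_pred_bounded lM cM.
have [->|x0] := eqVneq x 0; first by rewrite (linear_pred0 lM) !normr0 mulr0.
have n0 : 0 < `|x| by rewrite normr_gt0.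
rewrite -ler_pdivrMr//; apply: ub_le_sup.
  exists L => _ [y /= y1 <-]; rewrite (le_trans (ML y))//.
  by rewrite -[leRHS]mulr1 ler_pM2l.
exists (`|x|^-1 *: x) => /=.
  by rewrite normrZ ger0_norm ?invr_ge0// mulVf// gt_eqF.
by rewrite (linear_predZ lM) normrZ ger0_norm ?invr_ge0// mulrC.
Qed.

(** With u = w - T^-1 p, monotonicity of the subdifferential and coercivity of T^-1 give c |p -
    p'|^2 <= <w - w', p - p'>. *)
Lemma prox_lipschitz (R : realType) (H : hilbertType R) (T : H -> H)
    (g : H -> \bar R) : Spp T -> proper_efun g -> lower_semicontinuous g ->
  convex_efun g -> exists2 c : R, 0 < c & forall w w',
    `|prox T g (T w) - prox T g (T w')| <= c * `|w - w'|.
Proof.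
move=> T_Spp pg lg cg; have [c c0 coer] := Spp_pinv_coercive T_Spp.
exists c^-1 => [|w w']; first by rewrite invr_gt0.
have [u gu wE] := proxP T_Spp pg lg cg w.
have [u' gu' wE'] := proxP T_Spp pg lg cg w'.
move: gu gu' wE wE'; set p := prox T g (T w); set p' := prox T g (T w').
move=> gu gu' wE wE'.
have lTi := linear_Spp_pinv T_Spp.
have uE : u = w - pinv setT T p.
  rewrite -{1}(Spp_pinvKV T_Spp w) wE (linear_predD lTi) addrC addKr.
  by rewrite (Spp_pinvKV T_Spp).
have uE' : u' = w' - pinv setT T p'.
  rewrite -{1}(Spp_pinvKV T_Spp w') wE' (linear_predD lTi) addrC addKr.
  by rewrite (Spp_pinvKV T_Spp).
have [->|pp] := eqVneq p p'.
  by rewrite subrr normr0 mulr_ge0// invr_ge0 ltW.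
have n0 : 0 < `|p - p'| by rewrite normr_gt0 subr_eq0.
have mono : 0 <= hdot (p - p') (u - u').
  exact: (subdifferential_monotone pg cg).
rewrite ler_pdivlMl// -(ler_pM2r n0) -mulrA -expr2.
rewrite (le_trans (coer (p - p')))// (linear_predB lTi).
apply: le_trans (cauchy_schwarz _ _).
have : u - u' = (w - w') - (pinv setT T p - pinv setT T p').
  by rewrite uE uE' opprD addrACA -opprD.
move=> uuE; move: mono; rewrite uuE hdotBr subr_ge0.
by rewrite !(hdotC (p - p')).
Qed.

Section saddle_operator.
Context {R : realType} {H1 H2 : hilbertType R}.
Variables (K : {linear H1 -> H2}) (g : H1 -> \bar R) (f : H2 -> \bar R).
Hypothesis cK : continuous K.

(** The coupling by K and its adjoint is skew and cancels in the inner product. *)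
Lemma saddleA_monotone (m : R) :
  (forall x x' u u', subdifferential g x u -> subdifferential g x' u' ->
    m * `|x - x'| ^+ 2 <= hdot (x - x') (u - u')) ->
  (forall y y' v v', subdifferential f y v -> subdifferential f y' v' ->
    m * `|y - y'| ^+ 2 <= hdot (y - y') (v - v')) ->
  forall z a z' a', saddleA K g f z a -> saddleA K g f z' a' ->
    m * `|z - z'| ^+ 2 <= hdot (z - z') (a - a').
Proof.
move=> mg mf [x y] a [x' y'] a' [u [v [/= gu fv ->]]] [u' [v' [/= gu' fv' ->]]].
have nE : `|((x, y) : hprod H1 H2) - (x', y')| ^+ 2
    = `|x - x'| ^+ 2 + `|y - y'| ^+ 2 by rewrite [LHS]sqr_hprod_norm.
rewrite nE.
have -> : hdot (((x, y) : hprod H1 H2) - (x', y'))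
    (hpair (u + adjoint K y) (- K x + v)
     - hpair (u' + adjoint K y') (- K x' + v'))
  = hdot (x - x') (u + adjoint K y - (u' + adjoint K y'))
    + hdot (y - y') (- K x + v - (- K x' + v')) by [].
have := mg _ _ _ _ gu gu'; have := mf _ _ _ _ fv fv'.
have -> : u + adjoint K y - (u' + adjoint K y')
    = (u - u') + adjoint K (y - y').
  by rewrite (linear_predB (linear_adjoint cK)) opprD addrACA.
have -> : - K x + v - (- K x' + v') = (v - v') - K (x - x').
  by rewrite linearB opprD opprK addrACA addrC opprB [- _ + _]addrC.
rewrite [X in _ -> _ -> _ <= X + _]hdotDr [X in _ -> _ -> _ <= _ + X]hdotBr.
rewrite (hdotC (x - x') (adjoint _ _)) adjointE// (hdotC (y - y') (K _)).
by move: (hdot (K _) _) => ?; lra.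
Qed.

Context {T : H1 -> H1} {Sigma : H2 -> H2}.
Hypotheses (T_Spp : Spp T) (Sigma_Spp : Spp Sigma).

Lemma linear_metric0 : linear (metric0 K T Sigma).
Proof.
move=> a z z'; rewrite /metric0 /hpair; congr pair => /=.
  rewrite (linear_Spp_pinv T_Spp) (linear_adjoint cK) scalerBr opprD.
  by rewrite addrACA.
by rewrite linearP (linear_Spp_pinv Sigma_Spp) opprD -scalerN addrACA scalerDr.
Qed.

Hypotheses (gprop : proper_efun g) (glsc : lower_semicontinuous g).
Hypotheses (gconv : convex_efun g).
Hypotheses (fprop : proper_efun f) (flsc : lower_semicontinuous f).
Hypotheses (fconv : convex_efun f).

(* [metric0 + A] is block triangular, hence inverted by two successive proximal
   steps. *)
Lemma saddle_resolvent (w : hprod H1 H2) x y :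
  x = prox T g (T w.1) -> y = prox Sigma f (Sigma (w.2 + K (2 *: x))) ->
  saddleA K g f (hpair x y) (w - metric0 K T Sigma (hpair x y)).
Proof.
move=> xE yE.
have [u gu] := proxP T_Spp gprop glsc gconv w.1; rewrite -xE in gu *.
move=> /(congr1 (pinv setT T)).
rewrite (linear_predD (linear_Spp_pinv T_Spp)) !(Spp_pinvKV T_Spp) => uE.
have [v fv] := proxP Sigma_Spp fprop flsc fconv (w.2 + K (2 *: x)).
rewrite -yE in fv *.
move=> /(congr1 (pinv setT Sigma)).
rewrite (linear_predD (linear_Spp_pinv Sigma_Spp)) !(Spp_pinvKV Sigma_Spp).
move=> vE.
exists u, v; split=> //.
have -> : w = hpair w.1 w.2 by case: (w).
(* In the first row the two terms [adjoint K y] cancel, so x is independent of y; in the second row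
   - K x occurs twice, which is the origin of the extrapolation 2 x. *)
rewrite /metric0 /hpair; congr pair => /=.
  by rewrite uE opprB [_ + u]addrC addrACA subrr addr0.
have -> : w.2 = pinv setT Sigma y + v - K (2 *: x) by rewrite -vE addrK.
apply/eqP; rewrite subr_eq scaler_nat mulr2n linearD; apply/eqP.
by rewrite [RHS]addrACA -opprD [RHS]addrC (addrC v).
Qed.

Hypothesis M0_pos : succ0 (metric0 K T Sigma).

(** Minty's argument: for z' solving w + M_0 z in (M_0 + A) z', the test pair has w - a' = - M_0 (z
    - z'), and positivity of M_0 forces z = z'. *)
Lemma saddleA_maximal z w :
  (forall z' a', saddleA K g f z' a' -> 0 <= hdot (z - z') (w - a')) ->
  saddleA K g f z w.
Proof.
move=> h; have [sigma s0 coer] := M0_pos.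
pose w' := w + metric0 K T Sigma z.
pose x := prox T g (T w'.1).
pose y := prox Sigma f (Sigma (w'.2 + K (2 *: x))).
have Az' := @saddle_resolvent w' x y erefl erefl.
have := h _ _ Az'; set z' := hpair x y.
have -> : w - (w' - metric0 K T Sigma z')
    = - (metric0 K T Sigma z - metric0 K T Sigma z').
  by rewrite /w' -[w + _ - _]addrA opprD addrA subrr add0r.
move=> h1.
have M0B := linear_predB linear_metric0.
have zz' : z = z'.
  apply/eqP; rewrite -subr_eq0 -normr_eq0 -sqrf_eq0.
  have := coer (z - z'); rewrite hdotZl hdotxx M0B => h2.
  move: h1; rewrite [X in 0 <= X]hdotNr [X in 0 <= - X]hdotC => h1.
  have : sigma * `|z - z'| ^+ 2 <= 0 by lra.
  by rewrite pmulr_rle0// => h3; rewrite eq_le h3 sqr_ge0.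
by move: Az'; rewrite -/z' -zz' /w' addrK.
Qed.

End saddle_operator.

(** * One step of the algorithms as a perturbed resolvent step *)

Section pdhg_step.
Context {R : realType} {H1 H2 : hilbertType R} {r : nat}.
Variables (K : {linear H1 -> H2}) (g : H1 -> \bar R) (f : H2 -> \bar R).
Variables (G : H1 -> R) (F : H2 -> R).
Variables (T : H1 -> H1) (Sigma : H2 -> H2) (s : R).
Hypothesis cK : continuous K.
Hypotheses (T_Spp : Spp T) (Sigma_Spp : Spp Sigma).
Hypotheses (gprop : proper_efun g) (glsc : lower_semicontinuous g).
Hypotheses (gconv : convex_efun g).
Hypotheses (fprop : proper_efun f) (flsc : lower_semicontinuous f).
Hypotheses (fconv : convex_efun f).

Let linT : linear T := let: conj (And3 l _ _) _ := T_Spp in l.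
Let linSigma : linear Sigma := let: conj (And3 l _ _) _ := Sigma_Spp in l.

(** The second component extrapolates the exact x, as [pdhg_J] does, whereas the algorithms
    extrapolate the perturbed one. *)
Definition pdhg_hat (U : 'cV[R]_r -> hprod H1 H2) (zb : hprod H1 H2)
    (xi : 'cV[R]_r) : hprod H1 H2 :=
  let x := pdhg_x K g G T s U zb xi in
  hpair x (pdhg_y K f F Sigma s U zb x xi).

Let pdhg_yE (U : {linear 'cV[R]_r -> hprod H1 H2}) (zb : hprod H1 H2) x xi :
  pdhg_y K f F Sigma s U zb x xi = prox Sigma f (Sigma
    ((metric0 K T Sigma zb - saddleB G F zb - s *: U xi).2 + K (2 *: x))).
Proof.
rewrite /pdhg_y; congr prox.
have -> : (metric0 K T Sigma zb - saddleB G F zb - s *: U xi).2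
  = - K zb.1 + pinv setT Sigma zb.2 - gradient F zb.2 - s *: (U xi).2 by [].
rewrite linearB !(linear_predD linSigma) !(linear_predN linSigma).
rewrite (linear_predZ linSigma) (Spp_pinvK Sigma_Spp).
by rewrite [RHS](ACl (2*3*(5*1)*4)).
Qed.

(** The root equation says that xi is minus the adjoint of U at zb - zh. Thus - s U xi, explicit in
    the proximal arguments, is exactly the low-rank part of M_k (zb - zh), and only a resolvent of
    M_0 + A has to be evaluated. *)
Lemma pdhg_resolvent (U : {linear 'cV[R]_r -> hprod H1 H2}) zb xi :
  pdhg_J K g f G F T Sigma s U zb xi = 0 ->
  let zh := pdhg_hat U zb xi in
  saddleA K g f zh (metric K T Sigma s U (zb - zh) - saddleB G F zb).
Proof.
move=> J0 zh.
have UJ : U xi = - U (euclid_adjoint U (zb - zh)).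
  rewrite -linearN; congr (U _); apply/eqP; rewrite -addr_eq0 -J0 addrC.
  by apply/eqP; congr (_ + _); apply/colP => i; rewrite !mxE.
pose w := metric0 K T Sigma zb - saddleB G F zb - s *: U xi.
have -> : metric K T Sigma s U (zb - zh) - saddleB G F zb
    = w - metric0 K T Sigma zh.
  rewrite /metric /w UJ scalerN opprK.
  rewrite (linear_predB (linear_metric0 cK T_Spp Sigma_Spp)).
  by rewrite [LHS](ACl (1*4*3*2)).
apply: saddle_resolvent => //.
rewrite /pdhg_x; congr prox.
have -> : w.1 = pinv setT T zb.1 - adjoint K zb.2 - gradient G zb.1
  - s *: (U xi).1 by [].
rewrite !(linear_predB linT) (linear_predZ linT) (Spp_pinvK T_Spp).
by rewrite [RHS](ACl (1*3*2*4)).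
Qed.

(** The x-error reaches y through Sigma K (2 x), hence the factor c (L * 2); the constant is
    independent of U, zb and xi, so summability of eps is inherited. *)
Lemma pdhg_perturbation : exists2 C : R, 0 <= C &
  forall (U : {linear 'cV[R]_r -> hprod H1 H2}) (zb w e : hprod H1 H2) xi,
  w.1 = pdhg_x K g G T s U zb xi + e.1 ->
  w.2 = pdhg_y K f F Sigma s U zb w.1 xi + e.2 ->
  `|w - pdhg_hat U zb xi| <= C * `|e|.
Proof.
have lK : linear K by move=> a x y; rewrite linearP.
have [L L0 KL] := linear_pred_bounded lK cK.
have [c c0 lip] := prox_lipschitz Sigma_Spp fprop flsc fconv.
exists (1 + (c * (L * 2) + 1)) => [|U zb w e xi w1 w2].
  by rewrite !addr_ge0// !mulr_ge0 ?ltW.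
have e1 := ler_hprod_fst e; have e2 := ler_hprod_snd e.
rewrite (le_trans (ler_hprodD _))// mulrDl mul1r lerD//.
  by rewrite /= w1 addrC addKr.
have -> : (w - pdhg_hat U zb xi).2
    = (pdhg_y K f F Sigma s U zb w.1 xi
       - pdhg_y K f F Sigma s U zb (pdhg_x K g G T s U zb xi) xi) + e.2.
  by rewrite addrAC -w2.
rewrite (le_trans (ler_normD _ _))// mulrDl mul1r lerD// !pdhg_yE.
rewrite (le_trans (lip _ _))// -!mulrA ler_pM2l//.
rewrite opprD addrACA subrr add0r -linearB -scalerBr (le_trans (KL _))//.
rewrite ler_pM2l// normrZ ger0_norm// ler_pM2l//.
by rewrite w1 addrC addKr.
Qed.

End pdhg_step.

Section saddle_point.
Context {R : realType} {H1 H2 : hilbertType R}.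
Variables (K : {linear H1 -> H2}) (g : H1 -> \bar R) (f : H2 -> \bar R).
Variables (G : H1 -> R) (F : H2 -> R).

Lemma saddle_solutionE z : saddle_solution K g f G F z <->
  saddleA K g f z (- saddleB G F z).
Proof.
split=> [[a Aza /eqP]|Az]; first by rewrite addr_eq0 => /eqP <-.
by exists (- saddleB G F z) => //; rewrite addNr.
Qed.

(** One modulus is zero in each case; the other is a minimum because a single constant must serve
    both components of the product. *)
Lemma strongly_convex_moduli : continuous K ->
  proper_efun g -> convex_efun g -> proper_efun f -> convex_efun f ->
  C1_lipschitz_gradient G -> C1_lipschitz_gradient F ->
  forall beta, 0 < beta -> cocoercive beta (saddleB G F) ->
  (strongly_convex g /\ strongly_convex f)
    \/ (strongly_convex (EFin \o G) /\ strongly_convex (EFin \o F)) ->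
  exists mA mB : R, [/\ 0 <= mA, 0 <= mB, 0 < mA + mB,
    forall z a z' a', saddleA K g f z a -> saddleA K g f z' a' ->
      mA * `|z - z'| ^+ 2 <= hdot (z - z') (a - a')
    & forall z w, mB * `|z - w| ^+ 2
      <= hdot (z - w) (saddleB G F z - saddleB G F w)].
Proof.
move=> cK pg cg pf cf [dG _ _] [dF _ _] beta beta0 coco.
case=> -[[m1 m10 h1] [m2 m20 h2]].
  exists (Num.min m1 m2), 0; split=> //.
  - by rewrite le_min !ltW.
  - by rewrite addr0 lt_min m10.
  - apply: saddleA_monotone => //.
      move=> x x' u u' gu gu'; apply: le_trans (subdifferential_strong_monotone
        pg (ltW m10) h1 gu gu').
      by rewrite ler_wpM2r ?sqr_ge0// ge_min lexx.
    move=> x x' u u' gu gu'; apply: le_trans (subdifferential_strong_monotone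
      pf (ltW m20) h2 gu gu').
    by rewrite ler_wpM2r ?sqr_ge0// ge_min lexx orbT.
  - move=> z w; rewrite mul0r; exact: (cocoercive_ge0 beta0 coco).
have [m1' m1'0 h1'] : exists2 m : R, 0 < m & forall x y,
    m * `|x - y| ^+ 2 <= hdot (x - y) (gradient G x - gradient G y).
  by apply: strongly_convex_gradient => //; exists m1.
have [m2' m2'0 h2'] : exists2 m : R, 0 < m & forall x y,
    m * `|x - y| ^+ 2 <= hdot (x - y) (gradient F x - gradient F y).
  by apply: strongly_convex_gradient => //; exists m2.
exists 0, (Num.min m1' m2'); split=> //.
- by rewrite le_min !ltW.
- by rewrite add0r lt_min m1'0.
- apply: saddleA_monotone => //.
    move=> x x' u u' gu gu'.
    by rewrite mul0r (subdifferential_monotone pg cg gu).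
  by move=> x x' u u' gu gu'; rewrite mul0r (subdifferential_monotone pf cf gu).
move=> z w.
have nE : `|z - w| ^+ 2 = `|z.1 - w.1| ^+ 2 + `|z.2 - w.2| ^+ 2.
  by rewrite [LHS]sqr_hprod_norm.
have dE : hdot (z - w) (saddleB G F z - saddleB G F w)
  = hdot (z.1 - w.1) (gradient G z.1 - gradient G w.1)
    + hdot (z.2 - w.2) (gradient F z.2 - gradient F w.2) by [].
rewrite nE dE mulrDr; apply: lerD.
  apply: le_trans (h1' _ _).
  by rewrite ler_wpM2r ?sqr_ge0// ge_min lexx.
apply: le_trans (h2' _ _).
by rewrite ler_wpM2r ?sqr_ge0// ge_min lexx orbT.
Qed.

End saddle_point.

Lemma Sge_coercive (R : realType) (H : hilbertType R) (M : H -> H) (c a : R) :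
  Sge c (fun w => M w - a *: w) ->
  forall x, (a + c) * `|x| ^+ 2 <= hdot (M x) x.
Proof.
move=> [_ Mc] x; have := Mc x; rewrite hdotBl !hdotZl hdotxx; lra.
Qed.

Lemma opnorm_ubound (R : realType) (H : hilbertType R) (M : nat -> H -> H) :
  (forall k, bounded_selfadjoint (M k)) ->
  has_ubound (range (fun k => opnorm (M k))) ->
  exists2 C : R, 0 < C & forall k x, `|M k x| <= C * `|x|.
Proof.
move=> bM [b hb]; exists (`|b| + 1) => [|k x]; first by rewrite ltr_wpDl.
rewrite (le_trans (opnorm_bound (bM k) x))// ler_wpM2r//.
have : opnorm (M k) <= b by apply: hb; exists k.
by have := ler_norm b; lra.
Qed.

Theorem proposition6p6 (R : realType) (H1 H2 : hilbertType R) (r : nat)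
    (K : {linear H1 -> H2}) (g : H1 -> \bar R) (f : H2 -> \bar R)
    (G : H1 -> R) (F : H2 -> R) (beta : R)
    (T : H1 -> H1) (Sigma : H2 -> H2) (s : R)
    (U : nat -> {linear 'cV[R]_r -> hprod H1 H2})
    (eps : nat -> hprod H1 H2)
    (M := fun k => metric K T Sigma s (U k))
    (sol := saddle_solution K g f G F)
    (strong := (strongly_convex g /\ strongly_convex f)
            \/ (strongly_convex (EFin \o G) /\ strongly_convex (EFin \o F))) :
  continuous K ->
  proper_efun g -> lower_semicontinuous g -> convex_efun g ->
  proper_efun f -> lower_semicontinuous f -> convex_efun f ->
  convex_function setT G -> C1_lipschitz_gradient G ->
  convex_function setT F -> C1_lipschitz_gradient F ->
  (exists z, sol z) ->
  0 < beta -> cocoercive beta (saddleB G F) ->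
  Spp T -> Spp Sigma -> succ0 (metric0 K T Sigma) ->
  s = -1 \/ s = 1 ->
  (forall k, injective (U k)) ->
  cvgn (series (fun k => `|eps k|)) ->
  (* (i) *)
  (forall (sigma kappa Lambda : R) (eta alpha : nat -> R)
          (zm1 : hprod H1 H2) (z : nat -> hprod H1 H2) (xi : nat -> 'cV[R]_r)
          (dz := fun k => normM (M k) (z k - previous zm1 z k)),
    0 < sigma -> (forall k, Sge sigma (M k)) ->
    has_ubound (range (fun k => opnorm (M k))) ->
    summable_nneg eta ->
    (forall k, succeq (fun w => (1 + eta k) *: M k w) (M k.+1)) ->
    0 < kappa ->
    (forall k, Sge kappa (fun w => M k w - (1 / (2 * beta)) *: w)) ->
    inertial_pdhg K g f G F T Sigma s U alpha eps zm1 z xi ->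
    (forall k, 0 < alpha k <= Lambda) ->
    cvgn (series (fun k => alpha k * Num.max (dz k) (dz k ^+ 2))) ->
    exists zs, [/\ sol zs, weakly_cvg z zs
      & strong -> (forall k, eps k = 0) ->
        (exists2 kappa' : R, 0 < kappa' &
          forall k, Sge kappa' (fun w => M k w - (1 / beta) *: w)) ->
        exists (x Theta : R) (K0 : nat), [/\ 0 < x < 1, 0 < Theta
          & forall k, (K0 < k)%N ->
            normM (M k) (z k - zs) ^+ 2
            <= (1 - x) ^+ (k - K0) * normM (M K0) (z K0 - zs) ^+ 2
               + \sum_(K0 <= i < k) Theta * (1 - x) ^+ (k - i)
                   * alpha i * Num.max (dz i) (dz i ^+ 2)]])
  /\
  (* (ii) *)
  (forall (sigma c : R) (z zt : nat -> hprod H1 H2) (xi : nat -> 'cV[R]_r),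
    0 < sigma -> (forall k, Sge sigma (M k)) ->
    0 < c -> (forall k, Sge c (fun w => M k w - (1 / beta) *: w)) ->
    has_ubound (range (fun k => opnorm (M k))) ->
    relaxed_pdhg K g f G F T Sigma s U eps z zt xi ->
    (forall k, zt k != z k) ->
    (exists2 zs, sol zs & weakly_cvg z zs)
    /\ (strong -> (forall k, eps k = 0) ->
        exists2 x : R, 0 < x < 1 &
          forall zs, sol zs ->
          forall k, `|z k - zs| ^+ 2 <= (1 - x) ^+ k * `|z 0%N - zs| ^+ 2)).
Proof.
move=> cK pg lg cg pf lf cf _ dG _ dF [z0 z0sol] beta0 coco T_Spp S_Spp M0_pos.
move=> _ _ epsS.
set A := saddleA K g f; set B := saddleB G F.
have solE z : sol z <-> A z (- B z) by exact: saddle_solutionE.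
have A_max := saddleA_maximal cK T_Spp S_Spp pg lg cg pf lf cf M0_pos.
(* Modulus 0 for weak convergence; the rates take theirs from [moduli]. *)
have A_mono z a z' a' : A z a -> A z' a' ->
    0 * `|z - z'| ^+ 2 <= hdot (z - z') (a - a').
  apply: saddleA_monotone => //.
    move=> x x' u u' gu gu'.
    by rewrite mul0r (subdifferential_monotone pg cg gu).
  by move=> x x' u u' gu gu'; rewrite mul0r (subdifferential_monotone pf cf gu).
have B_mono z w : 0 * `|z - w| ^+ 2 <= hdot (z - w) (B z - B w).
  by rewrite mul0r; exact: (cocoercive_ge0 beta0 coco).
have exA : exists zs, A zs (- B zs) by exists z0; apply/solE.
have [Ce Ce0 pert] := @pdhg_perturbation _ _ _ r K g f G F T Sigma s cK
  S_Spp pf lf cf.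
have eS : summable_nneg (fun k => Ce * `|eps k|).
  by apply: summable_nnegZ => //; split.
have moduli : strong -> _ :=
  strongly_convex_moduli cK pg cg pf cf dG dF beta0 coco.
split.
  move=> sigma kappa Lambda eta alpha zm1 z xi dz sigma0 MS Mub etaS decM.
  move=> kappa0 Mkappa alg alphaL dzS.
  have bM k : bounded_selfadjoint (M k) by have [] := MS k.
  have linM k : linear (M k) by have [] := bM k.
  have symM k x y : hdot (M k x) y = hdot x (M k y) by have [_ _ ->] := bM k.
  have coerM k := Sge_coercive (Mkappa k).
  have [C C0 MC] := opnorm_ubound bM Mub.
  have decM' k x : hdot (M k.+1 x) x <= (1 + eta k) * hdot (M k x) x.
    by have := decM k x; rewrite hdotZl.
  have alpha0 k : 0 <= alpha k by have /andP[/ltW] := alphaL k.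
  have alphaL' k : alpha k <= Lambda by have /andP[] := alphaL k.
  have dzS' : summable_nneg (fun k => alpha k * dz k).
    apply: summable_nneg_le dzS => k.
    by rewrite mulr_ge0 ?sqrtr_ge0//= ler_wpM2l// le_max lexx.
  pose zp := previous zm1 z.
  pose zb k := z k + alpha k *: (z k - zp k).
  pose zh k := pdhg_hat K g f G F T Sigma s (U k) (zb k) (xi k).
  have zhE k : A (zh k) (M k (zb k - zh k) - B (zb k)).
    by apply: pdhg_resolvent => //; have [] := alg k.
  have zE k : `|z k.+1 - zh k| <= Ce * `|eps k|.
    by have [_ x1 y1] := alg k; exact: pert.
  have [zs zsA zsw] := inertial_weak_cvg beta0 coco (lexx 0) A_mono A_max linM
    symM kappa0 coerM C0 MC etaS decM' alpha0 dzS' eS zhE zE exA.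
  exists zs; split=> //; first exact/solE.
  move=> /moduli[mA [mB [mA0 mB0 mAB A_mono' B_mono']]] eps0 [kappa' k'0 Mk'].
  have zzh k : z k.+1 = zh k.
    apply/eqP; rewrite -subr_eq0 -normr_le0 (le_trans (zE k))//.
    by rewrite eps0 normr0 mulr0.
  apply: (inertial_linear_cvg beta0 coco mA0 mB0 A_mono' B_mono' linM symM
    kappa0 coerM C0 MC etaS decM' alpha0 dzS' eS zhE zE zsA mAB zzh _ alphaL').
  move=> k x; apply: le_trans (Sge_coercive (Mk' k) x).
  by rewrite ler_wpM2r ?sqr_ge0// lerDl ltW.
move=> sigma c z zt xi sigma0 MS c0 Mc Mub alg ztz.
have bM k : bounded_selfadjoint (M k) by have [] := MS k.
have linM k : linear (M k) by have [] := bM k.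
have symM k x y : hdot (M k x) y = hdot x (M k y) by have [_ _ ->] := bM k.
have coerM k := Sge_coercive (Mc k).
have [C C0 MC] := opnorm_ubound bM Mub.
pose zh k := pdhg_hat K g f G F T Sigma s (U k) (z k) (xi k).
have zhE k : A (zh k) (M k (z k - zh k) - B (z k)).
  by apply: pdhg_resolvent => //; have [] := alg k.
have zth k : `|zt k - zh k| <= Ce * `|eps k|.
  by have [_ x1 y1 _] := alg k; exact: pert.
have zS k := let: And4 _ _ _ h := alg k in h.
split.
  have [zs zsA zsw] := relaxed_weak_cvg beta0 coco (lexx 0) (lexx 0) A_mono
    B_mono A_max linM symM c0 coerM C0 MC zS zhE eS zth ztz exA.
  by exists zs => //; exact/solE.
move=> /moduli[mA [mB [mA0 mB0 mAB A_mono' B_mono']]] eps0.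
have ztE k : zt k = zh k.
  apply/eqP; rewrite -subr_eq0 -normr_le0 (le_trans (zth k))//.
  by rewrite eps0 normr0 mulr0.
have [x x01 lin] := relaxed_linear_cvg beta0 coco A_mono' B_mono' linM
  c0 coerM C0 MC zS zhE ztz mAB ztE.
by exists x => // zs /solE; exact: lin.
Qed.
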